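(* Let $0<\beta<1$ and $t>0$. The density $f_\beta(x,t)$ of the $\beta$-stable subordinator $D_\beta(t)$ is given in terms of the $H$-function by $$f_\beta(x,t)=\frac{1}{\beta t^{1/\beta}}\,\mathrm{H}^{0,1}_{1,1}\left[\frac{x}{t^{1/\beta}}\,\middle|\,\begin{matrix}(1-1/\beta,\,1/\beta)\\(0,1)\end{matrix}\right],\qquad x>0.$$
   Context: Stable subordinator: for $0<\beta<1$, $D_\beta(t)$, $t\ge 0$, is the one-dimensional Lévy process with non-decreasing sample paths, zero drift and Lévy measure $\frac{\beta}{\Gamma(1-\beta)x^{1+\beta}}\mathbb{I}_{(0,\infty)}(x)\,dx$; equivalently $\mathbb{E}(e^{-sD_\beta(t)})=e^{-ts^\beta}$ for $s>0$. For $t>0$, $f_\beta(\cdot,t)$ denotes the (continuous) probability density of $D_\beta(t)$ on $(0,\infty)$. Fox $H$-function: for integers $0\le m\le q$, $0\le n\le p$, complex numbers $a_k,b_l$, reals $A_k,B_l>0$ and $z>0$, $$\mathrm{H}^{m,n}_{p,q}\left[z\,\middle|\,\begin{matrix}(a_k,A_k)_{1,p}\\(b_l,B_l)_{1,q}\end{matrix}\right]=\frac{1}{2\pi i}\int_{c-i\infty}^{c+i\infty}\chi(s)z^{-s}\,ds,\qquad \chi(s)=\frac{\prod_{k=1}^{n}\Gamma(1-a_k-A_ks)\prod_{l=1}^{m}\Gamma(b_l+B_ls)}{\prod_{k=n+1}^{p}\Gamma(a_k+A_ks)\prod_{l=m+1}^{q}\Gamma(1-b_l-B_ls)},$$ where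 $z^{-s}=e^{-s\ln z}$, empty products equal $1$, and $c$ is a real number such that the singularities of $\Gamma(b_l+B_ls)$, $1\le l\le m$, lie entirely to the left of the path of integration and those of $\Gamma(1-a_k-A_ks)$, $1\le k\le n$, lie entirely to the right. The upper row lists the pairs $(a_k,A_k)$ in order, the lower row the pairs $(b_l,B_l)$ in order. *)

(* Defs.v *)
From HB Require Import structures.
From mathcomp Require Import all_boot all_order all_algebra.
From mathcomp Require Import all_classical all_reals all_analysis.
From mathcomp Require Import complex.

Set Implicit Arguments.
Unset Strict Implicit.
Unset Printing Implicit Defensive.

Import Order.TTheory GRing.Theory Num.Theory.
Import numFieldNormedType.Exports.

Local Open Scope classical_set_scope.
Local Open Scope ring_scope.
Local Open Scope complex_scope.

Section complex_gamma.
Context {R : realType}.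
Implicit Types (z : R[i]) (x : R).

Definition cexp z : R[i] :=
  (expR (complex.Re z))%:C * (cos (complex.Im z) +i* sin (complex.Im z)).

(* principal value of x ^ z; only meaningful for 0 < x *)
Definition cpow x z : R[i] := cexp (z * (ln x)%:C).

Definition gamma_integrand z x : R[i] := cpow x (z - 1) * (expR (- x))%:C.

Definition gamma_integral z : R[i] :=
  (\int[lebesgue_measure]_(x in `]0, +oo[) complex.Re (gamma_integrand z x))
  +i* (\int[lebesgue_measure]_(x in `]0, +oo[) complex.Im (gamma_integrand z x)).

(* The least number of unit shifts bringing z into the half-plane 0 < Re:
   truncn is the floor, and 0 on negative reals. *)
Definition gamma_shift z : nat := Num.truncn (1 - complex.Re z).

(* Euler's integral continued by Gamma (z + 1) = z * Gamma z. At the poles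
   0, -1, -2, ... the product below vanishes, so that Gamma z = 0 and
   (Gamma z)^-1 = 0, which is the value there of the entire function 1/Gamma. *)
Definition Gamma z : R[i] :=
  gamma_integral (z + (gamma_shift z)%:R) / \prod_(j < gamma_shift z) (z + j%:R).

Definition Gamma_singular z : Prop := exists j : nat, z = - j%:R.

End complex_gamma.

Section fox_H.
Context {R : realType}.
Implicit Types (g : R -> R[i]) (m n : nat) (up lo : seq (R[i] * R)) (z c : R).

(* Improper integral over the real line, the two ends going to infinity
   independently. *)
Definition is_improper_integral g (v : R[i]) : Prop :=
  let mu := @lebesgue_measure R in
  [/\ forall a b, mu.-integrable `[a, b] (fun y => (complex.Re (g y))%:E) /\
                  mu.-integrable `[a, b] (fun y => (complex.Im (g y))%:E),
      (\int[mu]_(y in `[ab.1, ab.2]) complex.Re (g y))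
        @[ab --> filter_prod -oo_R +oo_R] --> complex.Re v
    & (\int[mu]_(y in `[ab.1, ab.2]) complex.Im (g y))
        @[ab --> filter_prod -oo_R +oo_R] --> complex.Im v].

(* Integral of F along the line s = c + i y, so that ds = i dy. *)
Definition is_vertical_integral c (F : R[i] -> R[i]) (v : R[i]) : Prop :=
  is_improper_integral (fun y => F (c +i* y) * 'i) v.

(* up lists the pairs (a_k, A_k) for k = 1 .. p, and lo the pairs (b_l, B_l)
   for l = 1 .. q. *)
Definition foxH_chi m n up lo (s : R[i]) : R[i] :=
  ((\prod_(k <- take n up) Gamma (1 - k.1 - k.2%:C * s)) *
   (\prod_(l <- take m lo) Gamma (l.1 + l.2%:C * s))) /
  ((\prod_(k <- drop n up) Gamma (k.1 + k.2%:C * s)) *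
   (\prod_(l <- drop m lo) Gamma (1 - l.1 - l.2%:C * s))).

Definition foxH_separates m n up lo c : Prop := forall s : R[i],
  (forall l : R[i] * R, l \in take m lo ->
     Gamma_singular (l.1 + l.2%:C * s) -> complex.Re s < c) /\
  (forall k : R[i] * R, k \in take n up ->
     Gamma_singular (1 - k.1 - k.2%:C * s) -> c < complex.Re s).

Definition foxH_params m n up lo z : Prop :=
  [/\ (m <= size lo)%N, (n <= size up)%N,
      forall k, k \in up -> 0 < k.2,
      forall l, l \in lo -> 0 < l.2 & 0 < z].

(* h is the value of the H-function at z: some line separates the
   singularities, and each such line gives a convergent integral with the
   value h. *)
Definition is_foxH m n up lo z (h : R[i]) : Prop :=
  [/\ foxH_params m n up lo z,
      exists c, foxH_separates m n up lo c
    & forall c, foxH_separates m n up lo c ->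
      exists2 v,
        is_vertical_integral c
          (fun s => foxH_chi m n up lo s * cpow z (- s)) v
      & h = v / (2 * (pi : R)%:C * 'i)].

(* 0 where the H-function is not defined *)
Definition foxH m n up lo z : R[i] :=
  xget 0 [set h | is_foxH m n up lo z h].

End fox_H.

Section stable_subordinator.
Context {R : realType} {d : measure_display} {T : measurableType d}.
Variable P : probability T R.

(* A process is indexed by all of R for convenience; its values at negative
   times are never constrained. *)

(* Mutual independence: any subfamily of the events is obtained by taking
   the other B i equal to setT. *)
Definition independent_increments (D : R -> {RV P >-> R}) : Prop :=
  forall (k : nat) (u : nat -> R) (B : nat -> set R),
    0 <= u 0%N -> (forall i, u i <= u i.+1) -> (forall i, measurable (B i)) ->
    P (\bigcap_(i in `I_k) [set w | B i (D (u i.+1) w - D (u i) w)]) =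
    (\prod_(i < k) P [set w | B i (D (u i.+1) w - D (u i) w)%R])%E.

Definition stationary_increments (D : R -> {RV P >-> R}) : Prop :=
  forall (s t : R) (B : set R), 0 <= s -> 0 <= t -> measurable B ->
    P [set w | B (D (s + t) w - D s w)] = P [set w | B (D t w - D 0 w)].

Definition stochastically_continuous (D : R -> {RV P >-> R}) : Prop :=
  forall s e : R, 0 <= s -> 0 < e ->
    P [set w | e < `|D u w - D s w|] @[u --> within [set u | 0 <= u] (nbhs s)]
      --> 0%E.

Definition cadlag_paths (D : R -> {RV P >-> R}) : Prop :=
  {ae P, forall w, forall s : R, 0 <= s ->
    D u w @[u --> s^'+] --> D s w /\ (0 < s -> cvg (D u w @[u --> s^'-]))}.

Definition levy_process (D : R -> {RV P >-> R}) : Prop :=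
  [/\ {ae P, forall w, D 0 w = 0},
      independent_increments D,
      stationary_increments D,
      stochastically_continuous D
    & cadlag_paths D].

Definition nondecreasing_paths (D : R -> {RV P >-> R}) : Prop :=
  {ae P, forall w, forall s t : R, 0 <= s -> s <= t -> D s w <= D t w}.

Definition stable_subordinator (beta : R) (D : R -> {RV P >-> R}) : Prop :=
  [/\ levy_process D,
      nondecreasing_paths D
    & forall s t : R, 0 < s -> 0 <= t ->
      'E_P[fun w => expR (- s * D t w)]%E = (expR (- t * s `^ beta))%:E].

(* f is the continuous density on ]0, +oo[ of the law of X; its values
   elsewhere are irrelevant. *)
Definition is_continuous_density (X : {RV P >-> R}) (f : R -> R) : Prop :=
  [/\ forall x : R, 0 < x -> 0 <= f x,
      forall x : R, 0 < x -> {for x, continuous f}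
    & forall A : set R, measurable A ->
      P (X @^-1` A) =
      (\int[lebesgue_measure]_(x in A `&` `]0%R, +oo[) (f x)%:E)%E].

End stable_subordinator.

(* Main.v *)
(** The proof computes the Mellin transform of the density and inverts it.  For
  X = D_beta(t) and Re w > 0, integrating Gamma(w) X^(-w) = int s^(w-1) e^(-s X) ds
  against the law of X and using the Laplace transform gives
    Gamma(w) E[X^(-w)] = beta^(-1) t^(-w/beta) Gamma(w/beta),
  so that on the line s = 1 - w the integrand chi(s) z^(-s) of the H-function is
  a multiple of the Mellin transform of f_beta(., t); in the variable v = ln x
  this is the Fourier transform of the weighted density of ln X.  It decays
  exponentially, hence Fourier inversion applies and returns the density.

  No Stirling formula is needed for the decay.  By the functional equation,
  Gamma(w/beta)/Gamma(w) is Gamma(w/beta + N)/Gamma(w + N) times the product of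
  (w + k)/(w/beta + k) over k < N.  Once N > (Im w)^2 the first quotient is
  comparable to its value on the real axis, and, relative to the real axis, about
  |Im w| of the factors have modulus at most a constant rho < 1, the others at
  most 1. *)

Require Import Defs.
From HB Require Import structures.
From mathcomp Require Import all_boot all_order all_algebra.
From mathcomp Require Import all_classical all_reals all_analysis.
From mathcomp Require Import measurable_realfun complex zify ring lra.
Import Order.TTheory GRing.Theory Num.Theory.
Import numFieldNormedType.Exports.
Local Open Scope classical_set_scope.
Local Open Scope ring_scope.
Local Open Scope complex_scope.

Set Implicit Arguments.
Unset Strict Implicit.
Unset Printing Implicit Defensive.

(** An H-function value has to be produced on every separating line, that is for every c < 1, so the
    decay and the inversion are proved for an arbitrary real part u = 1 - c > 0. The lower bound on
    |Gamma| far to the right is used twice. Pulled back by the functional equation, it shows that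
    Gamma has no zero where Re w > 0, so that chi can be rewritten as a Mellin transform, and it
    bounds the denominator of Gamma(w/beta)/Gamma(w) in the decay estimate. The density is only
    known to be continuous and may be unbounded near 0, so inversion has to be pointwise and without
    smoothness. The Fourier integral is regularised by exp(-e |y|), which turns it into a Poisson
    integral converging at each point of continuity. Decay of the transform then removes the
    regularisation by dominated convergence. Every Euler or Mellin integral is moved to the whole
    line by x = exp r. Scaling becomes translation there, and the integrands are continuous
    everywhere, without an endpoint at 0. *)

Section real_calculus.
Context {R : realType}.
Implicit Types (f g : R -> R).

Lemma continuous_comp_fun f g :
  continuous f -> continuous g -> continuous (fun x => f (g x)).
Proof. by move=> cf cg x; apply: continuous_comp; [exact: cg|exact: cf]. Qed.

Lemma continuous_mul_fun f g :
  continuous f -> continuous g -> continuous (fun x => f x * g x).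
Proof. by move=> cf cg x; apply: cvgM; [exact: cf|exact: cg]. Qed.

Lemma continuous_add_fun f g :
  continuous f -> continuous g -> continuous (fun x => f x + g x).
Proof. by move=> cf cg x; apply: cvgD; [exact: cf|exact: cg]. Qed.

Lemma continuous_opp_fun f : continuous f -> continuous (fun x => - f x).
Proof. by move=> cf x; apply: cvgN; exact: cf. Qed.

Lemma continuous_norm_fun f : continuous f -> continuous (fun x => `|f x|).
Proof. by move=> cf x; apply: cvg_norm; exact: cf. Qed.

Lemma is_derive_mul_fun f g (x a b : R) : is_derive x 1 f a -> is_derive x 1 g b ->
  is_derive x 1 (fun z => f z * g z) (a * g x + f x * b).
Proof.
move=> df dg; apply: is_derive_eq (is_deriveM df dg) _.
by rewrite /GRing.scale /= addrC [a * _]mulrC.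
Qed.

Lemma is_derive_add_fun f g (x a b : R) : is_derive x 1 f a -> is_derive x 1 g b ->
  is_derive x 1 (fun z => f z + g z) (a + b).
Proof. by move=> df dg; exact: is_deriveD. Qed.

Lemma is_derive_opp_fun f (x a : R) :
  is_derive x 1 f a -> is_derive x 1 (fun z => - f z) (- a).
Proof. by move=> df; exact: is_deriveN. Qed.

Lemma is_derive_scale_fun (k x : R) : is_derive x 1 (fun z => k * z) k.
Proof.
apply: is_derive_eq (is_derive_mul_fun (is_derive_cst k x 1) (is_derive_id x 1)) _.
by rewrite mul0r add0r mulr1.
Qed.

Lemma is_derive_expR_fun g (x b : R) :
  is_derive x 1 g b -> is_derive x 1 (fun z => expR (g z)) (expR (g x) * b).
Proof. by move=> dg; exact: (is_derive1_comp (is_derive_expR _) dg). Qed.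

Lemma is_derive_cos_fun g (x b : R) :
  is_derive x 1 g b -> is_derive x 1 (fun z => cos (g z)) (- sin (g x) * b).
Proof. by move=> dg; exact: (is_derive1_comp (is_derive_cos _) dg). Qed.

Lemma is_derive_sin_fun g (x b : R) :
  is_derive x 1 g b -> is_derive x 1 (fun z => sin (g z)) (cos (g x) * b).
Proof. by move=> dg; exact: (is_derive1_comp (is_derive_sin _) dg). Qed.

End real_calculus.

(** Recursion on the body of the function. The patterns [@?f x] recover the operands as explicit
    functions, so that nothing is left to higher-order unification. The case of a general head
    symbol has to come after the specific ones. *)
Ltac cont := cbv beta; try match goal with H : ?P |- ?P => exact: H end;
  lazymatch goal with
  | |- continuous (fun _ => ?c) => move=> ?; exact: cvg_cst
  | |- continuous (fun x => x) => move=> ?; exact: cvg_id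
  | |- continuous (fun x => - @?f x) =>
      refine (@continuous_opp_fun _ f _); cont
  | |- continuous (fun x => @?f x + @?g x) =>
      refine (@continuous_add_fun _ f g _ _); cont
  | |- continuous (fun x => @?f x * @?g x) =>
      refine (@continuous_mul_fun _ f g _ _); cont
  | |- continuous (fun x => `|@?f x|) =>
      refine (@continuous_norm_fun _ f _); cont
  | |- continuous (fun x => expR (@?f x)) =>
      refine (continuous_comp_fun (@continuous_expR _) (g := f) _); cont
  | |- continuous (fun x => cos (@?f x)) =>
      refine (continuous_comp_fun (@continuous_cos _) (g := f) _); cont
  | |- continuous (fun x => sin (@?f x)) =>
      refine (continuous_comp_fun (@continuous_sin _) (g := f) _); cont
  | |- continuous (fun x => ?f (@?g x)) =>
      refine (@continuous_comp_fun _ f g _ _); cont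
  | |- continuous _ => idtac
  end.

(** The value of the derivative stays an existential variable that the rules fill in;
    [notypeclasses] prevents instance search from guessing it. [derive] then leaves the equation
    between the computed and the stated derivative. *)
Ltac deriv := repeat first
  [ exact: is_derive_cst | exact: is_derive_id | exact: is_derive_scale_fun
  | exact: is_derive_expR
  | notypeclasses refine (is_derive_opp_fun _)
  | notypeclasses refine (is_derive_add_fun _ _)
  | notypeclasses refine (is_derive_mul_fun _ _)
  | notypeclasses refine (is_derive_expR_fun _)
  | notypeclasses refine (is_derive_cos_fun _)
  | notypeclasses refine (is_derive_sin_fun _) ].

Ltac derive := notypeclasses refine (is_derive_eq _ _); [deriv|].

(** * Quadratic bounds for cosine and hyperbolic cosine *)

Section elementary_bounds.
Context {R : realType}.

Lemma normr_sin_le (x : R) : `|sin x| <= `|x|.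
Proof.
wlog x0 : x / 0 <= x => [hw|].
  have [/hw//|/ltW x0] := leP 0 x.
  by rewrite -normrN -sinN -[leRHS]normrN hw// oppr_ge0.
have [c _] := @MVT_segment R sin cos 0 x x0 (fun z _ => is_derive_sin z)
  (continuous_subspaceT (@continuous_sin R)).
by rewrite sin0 !subr0 => ->; rewrite normrM ler_piMl// cos_max.
Qed.

Lemma cos_ge_parabola (x : R) : 1 - x ^+ 2 / 2 <= cos x.
Proof.
have -> : cos x = 1 - 2 * sin (x / 2) ^+ 2.
  rewrite {1}(splitr x) -mulr2n cos_mulr2n.
  by have := cos2Dsin2 (x / 2); lra.
have : sin (x / 2) ^+ 2 <= (x / 2) ^+ 2.
  by rewrite -real_normK ?num_real// -[leRHS]real_normK ?num_real//
    lerXn2r ?nnegrE ?normr_sin_le.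
by rewrite expr_div_n; lra.
Qed.

(** With x = 2 s the right side is the square of exp s - exp(-s), which is at least 2 s because its
    derivative is at least 2. This bounds (r - ln v)^2 by exponentials in r, whose integrals against
    the Gamma kernel are again Gamma values. *)
Lemma sqr_le_cosh (x : R) : x ^+ 2 <= expR x + expR (- x) - 2.
Proof.
wlog x0 : x / 0 <= x => [hw|].
  have [/hw//|/ltW x0] := leP 0 x.
  by have := hw (- x); rewrite oppr_ge0 opprK sqrrN [_ + expR x]addrC; exact.
pose s := x / 2.
have s0 : 0 <= s by rewrite /s divr_ge0.
have E0 : 0 < expR s by exact: expR_gt0.
have h : 2 * s <= expR s - (expR s)^-1.
  have [||c _] := @MVT_segment R (fun z => expR z - expR (- z))
    (fun z => expR z + expR (- z)) 0 s s0.
  - by move=> z _; derive; rewrite mulrN1 opprK.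
  - by apply: continuous_subspaceT; cont.
  rewrite !subr0 oppr0 subrr subr0 -expRN => ->.
  rewrite ler_wpM2r// expRN.
  have C0 : 0 < expR c by exact: expR_gt0.
  rewrite -subr_ge0 (_ : _ - 2 = (expR c - 1) ^+ 2 / expR c).
    by rewrite divr_ge0 ?sqr_ge0 ?ltW.
  by field; rewrite gt_eqF.
have -> : expR x + expR (- x) - 2 = (expR s - (expR s)^-1) ^+ 2.
  rewrite expRN (splitr x) -/s expRD; field.
  by rewrite gt_eqF.
have -> : x ^+ 2 = (2 * s) ^+ 2 by rewrite /s; congr (_ ^+ 2); field.
by rewrite lerXn2r ?nnegrE// ?mulr_ge0//; apply: le_trans h; rewrite mulr_ge0.
Qed.

End elementary_bounds.

(** * Integrals over the real line *)

Section integrals_on_the_line.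
Context {R : realType}.
Local Notation mu := (@lebesgue_measure R).
Implicit Types (f g h F : R -> R).

Lemma integrable_dominated g h : measurable_fun setT g ->
  (forall x, `|g x| <= h x) -> mu.-integrable setT (EFin \o h) ->
  mu.-integrable setT (EFin \o g).
Proof.
move=> mg gh ih; apply: (le_integrable _ _ _ ih) => //.
  exact/measurable_EFinP.
by move=> x _ /=; rewrite lee_fin (le_trans (gh x))// ler_norm.
Qed.

Lemma oneDsqr_gt0 (x : R) : 0 < 1 + x ^+ 2.
Proof. by rewrite ltr_pwDl ?ltr01 ?sqr_ge0. Qed.

Lemma continuous_oneDsqrV_fun : continuous (fun x : R => (1 + x ^+ 2)^-1).
Proof. exact: continuous_oneDsqrV. Qed.

Lemma integral_oneDsqrV : (\int[mu]_x ((1 + x ^+ 2)^-1)%:E = (pi : R)%:E)%E.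
Proof.
rewrite ge0_symfun_integralT.
- rewrite -set_itvcy integral0y_oneDsqr -EFinM; congr EFin; by field.
- by move=> x; rewrite invr_ge0 ltW ?oneDsqr_gt0.
- exact: continuous_oneDsqrV_fun.
- by move=> x /=; rewrite sqrrN.
Qed.

Lemma integrable_ge0 g : measurable_fun setT g -> (forall x, 0 <= g x) ->
  (\int[mu]_x (g x)%:E < +oo)%E -> mu.-integrable setT (EFin \o g).
Proof.
move=> mg g0 ltg; apply/integrableP; split; first exact/measurable_EFinP.
by under eq_integral do rewrite /= ger0_norm//.
Qed.

Lemma integrable_oneDsqrV :
  mu.-integrable setT (EFin \o (fun x : R => (1 + x ^+ 2)^-1)).
Proof.
apply: integrable_ge0.
- exact: continuous_measurable_fun continuous_oneDsqrV_fun.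
- by move=> x; rewrite invr_ge0 ltW ?oneDsqr_gt0.
- by rewrite integral_oneDsqrV ltry.
Qed.

Lemma integrable_scale k g : mu.-integrable setT (EFin \o g) ->
  mu.-integrable setT (EFin \o (fun x => k * g x)).
Proof.
move=> ig; rewrite (_ : _ \o _ = fun x => k%:E * (EFin \o g) x)%E//.
exact: integrableZl.
Qed.

Lemma integrable_add f g : mu.-integrable setT (EFin \o f) ->
  mu.-integrable setT (EFin \o g) ->
  mu.-integrable setT (EFin \o (fun x => f x + g x)).
Proof.
move=> i_f ig; rewrite (_ : _ \o _ = (EFin \o f) \+ (EFin \o g))%E//.
exact: integrableD.
Qed.

Lemma integrable_expR_norm c : 0 < c ->
  mu.-integrable setT (EFin \o (fun x => expR (- (c * `|x|)))).
Proof.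
(* Since exp(c |x|) >= 1 + c^2 x^2 / 2, this [m] is the constant for which exp(c |x|) >= m (1 +
   x^2). *)
move=> c0; pose m := Num.min 1 (c ^+ 2 / 2).
have m0 : 0 < m by rewrite lt_min ltr01 divr_gt0 ?exprn_gt0.
apply: (@integrable_dominated _ (fun x => m^-1 * (1 + x ^+ 2)^-1)).
- by apply: continuous_measurable_fun; cont.
- move=> x; rewrite ger0_norm ?expR_ge0// expRN -invfM lef_pV2 ?posrE ?expR_gt0//; last first.
    by rewrite mulr_gt0// oneDsqr_gt0.
  apply: le_trans (expR_ge1Dxn 1 _); last by rewrite mulr_ge0// ltW.
  rewrite mulrDr mulr1 lerD ?ge_min ?lexx// exprMn real_normK ?num_real//.
  by rewrite mulrAC ler_wpM2r ?sqr_ge0// ge_min lexx orbT.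
- exact/integrable_scale/integrable_oneDsqrV.
Qed.

(** Once [a, b] contains [J N], the missing part of the integral is at most the integral of |g|
    outside [J N], wherever a and b are. The symmetric intervals thus control two independent ends,
    and for them monotone convergence suffices. *)
Lemma cvg_improper_integral g : mu.-integrable setT (EFin \o g) ->
  (\int[mu]_(y in `[ab.1, ab.2]) g y) @[ab --> filter_prod -oo_R +oo_R]
    --> \int[mu]_y g y.
Proof.
move=> ig; have mg : measurable_fun setT g.
  by apply/measurable_EFinP; case/integrableP : ig.
pose J (n : nat) := `[- n%:R : R, n%:R]%classic.
have ig' : mu.-integrable setT (EFin \o (fun x => `|g x|)) by exact: integrable_norm.
have ifin (A : set R) : measurable A -> mu.-integrable A (EFin \o g).
  by move=> mA; exact: integrableS ig.
have ifin' (A : set R) : measurable A -> mu.-integrable A (EFin \o (fun x => `|g x|)).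
  by move=> mA; exact: integrableS ig'.
have mJ n : measurable (J n) by exact: measurable_itv.
have mC' n : measurable (~` J n) by exact: measurableC.
have cJ : (\int[mu]_(y in J n) `|g y|) @[n --> \oo] --> \int[mu]_y `|g y|.
  apply: fine_cvg; rewrite fineK; last exact: integrable_fin_num ig'.
  have -> : [set: R] = \bigcup_n J n.
    apply/seteqP; split => // x _; exists (Num.trunc `|x|).+1 => //=.
    rewrite /J /= in_itv /= -ler_norml ltW//.
    by rewrite truncnS_gt.
  apply: ge0_nondecreasing_set_cvg_integral => //.
  - move=> m n mn; rewrite subsetEset => x; rewrite /J /= !in_itv /= -!ler_norml => /le_trans.
    by apply; rewrite ler_nat.
  - by move=> n; case/integrableP: (ifin' _ (mJ n)).
apply/cvgrPdist_le => e e0.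
have /cvgrPdist_le/(_ e e0)[N _ HN] := cJ.
have {}HN := HN N (leqnn N).
near=> ab.
have aN : ab.1 <= - N%:R.
  near: ab; apply: (@cvg_fst _ _ -oo_R +oo_R _ _ (nbhs_ninfty_le (num_real (- N%:R : R)))).
have bN : N%:R <= ab.2.
  near: ab; apply: (@cvg_snd _ _ -oo_R +oo_R _ _ (nbhs_pinfty_ge (num_real (N%:R : R)))).
have sJ : J N `<=` `[ab.1, ab.2].
  by move=> x; rewrite /J /= !in_itv /= => /andP[h1 h2]; rewrite (le_trans aN)//= (le_trans h2).
have split_int (h : R -> R) (A : set R) : measurable A -> mu.-integrable setT (EFin \o h) ->
    \int[mu]_y h y - \int[mu]_(y in A) h y = \int[mu]_(y in ~` A) h y.
  move=> mA ih; rewrite -[in LHS](setUv A) Rintegral_setU// ?setUv//.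
  - by rewrite addrC addKr.
  - exact: measurableC.
  - exact/disj_setPCl.
rewrite split_int//; apply: le_trans HN; rewrite split_int//.
rewrite [leRHS]ger0_norm; last by apply: Rintegral_ge0.
have mC (a b : R) : measurable (~` `[a, b]%classic) by exact: measurableC.
apply: le_trans (le_normr_Rintegral _ (ifin _ _)) _; [exact: measurableC|exact: measurableC|].
rewrite /Rintegral fine_le ?(integrable_fin_num _ (ifin' _ _))//; [exact: mC|exact: mC'|].
apply: ge0_subset_integral => //; [exact: mC|exact: mC'| |].
- by case/integrableP: (ifin' _ (mC' N)).
- exact: subsetC.
Unshelve. all: by end_near. Qed.

End integrals_on_the_line.

(** * Limits of integrals and changes of variable *)

Section substitutions.
Context {R : realType}.
Local Notation mu := (@lebesgue_measure R).
Implicit Types (f g h F G : R -> R).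

Lemma cvg_integral_centered g : mu.-integrable setT (EFin \o g) ->
  (\int[mu]_(y in `[- n%:R, n%:R]) g y) @[n --> \oo] --> \int[mu]_y g y.
Proof.
move=> ig.
have cnat : (n%:R : R) @[n --> \oo] --> +oo by exact: cvgr_idn.
have cnatN : (- n%:R : R) @[n --> \oo] --> -oo by apply/cvgNrNy; exact: cvgr_idn.
apply: (@cvg_comp _ _ _ (fun n => (- n%:R, n%:R))
  (fun ab : R * R => \int[mu]_(y in `[ab.1, ab.2]) g y) \oo
  (filter_prod -oo_R +oo_R)); last exact: cvg_improper_integral.
exact: (@cvg_pair _ _ _ \oo -oo_R +oo_R _ _ _ _ _ cnatN cnat).
Qed.

Lemma Rintegral_derive F g (a b : R) : a < b -> continuous g ->
  (forall x : R, is_derive x 1 F (g x)) ->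
  \int[mu]_(x in `[a, b]) g x = F b - F a.
Proof.
move=> ab cg dF.
have dF1 x : derivable F x 1 by case: (dF x).
have cF : continuous F.
  by move=> x; apply/differentiable_continuous/derivable1_diffP; exact: dF1.
rewrite /Rintegral (@continuous_FTC2 _ g F) //.
- exact: continuous_subspaceT.
- split=> [x _||].
  + exact: dF1.
  + exact/cvg_at_right_filter/cF.
  + exact/cvg_at_left_filter/cF.
- by move=> x _; rewrite derive1E; exact: derive_val.
Qed.

Lemma integral_derive_line F g (L l : R) : continuous g ->
  (forall x : R, is_derive x 1 F (g x)) -> mu.-integrable setT (EFin \o g) ->
  F n%:R @[n --> \oo] --> L -> F (- n%:R) @[n --> \oo] --> l ->
  \int[mu]_x g x = L - l.
Proof.
move=> cg dF ig FL Fl.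
apply: (cvg_unique _ (cvg_integral_centered ig)) => //.
apply: cvg_trans (cvgB FL Fl); apply: near_eq_cvg; near=> n => /=.
have n0 : 0 < n%:R :> R by rewrite ltr0n; near: n; exact: nbhs_infty_gt.
by rewrite (@Rintegral_derive F g)// gtrN.
Unshelve. all: by end_near. Qed.

Lemma Rintegral_dominated_cvg (f_ : nat -> R -> R) f g :
  (forall n, measurable_fun setT (f_ n)) -> measurable_fun setT f ->
  (forall x, f_ n x @[n --> \oo] --> f x) ->
  mu.-integrable setT (EFin \o g) -> (forall n x, `|f_ n x| <= g x) ->
  \int[mu]_x f_ n x @[n --> \oo] --> \int[mu]_x f x.
Proof.
move=> mf_ mf f_f ig f_g.
have [] := @dominated_convergence _ _ _ mu setT measurableT
  (fun n x => (f_ n x)%:E) (fun x => (f x)%:E) (EFin \o g).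
- by move=> n; apply/measurable_EFinP; exact: mf_.
- by apply/measurable_EFinP; exact: mf.
- by apply: aeW => x _; apply: cvg_EFin; [exact: nearW|exact: f_f].
- exact: ig.
- by apply: aeW => x n _; rewrite /= lee_fin.
move=> i_f _ c.
by apply: fine_cvg; rewrite fineK; [exact: c|exact: integrable_fin_num i_f].
Qed.

Lemma max0_normE G x : Num.max (G x) 0 = (G x + `|G x|) / 2.
Proof. by rewrite maxr_absE addr0 subr0. Qed.

Lemma continuous_pos_part G : continuous G -> continuous (fun x => Num.max (G x) 0).
Proof.
by move=> cG; rewrite (funext (max0_normE G)); cont.
Qed.

(* The positive and the negative part are transported separately, so that no
   integrability is needed. *)
Lemma integral_split_eq (D D' : set R) f g :
  (\int[mu]_(x in D) (Num.max (f x) 0)%:E = \int[mu]_(x in D') (Num.max (g x) 0)%:E)%E ->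
  (\int[mu]_(x in D) (Num.max (- f x) 0)%:E = \int[mu]_(x in D') (Num.max (- g x) 0)%:E)%E ->
  (\int[mu]_(x in D) (f x)%:E = \int[mu]_(x in D') (g x)%:E)%E.
Proof.
move=> hp hn; rewrite integralE [RHS]integralE.
have E (A : set R) (k : R -> R) :
    (\int[mu]_(x in A) ((fun x => (k x)%:E)^\+)%E x = \int[mu]_(x in A) (Num.max (k x) 0)%:E)%E.
  by apply: eq_integral => x _; rewrite funeposE EFin_max.
have E' (A : set R) (k : R -> R) :
    (\int[mu]_(x in A) ((fun x => (k x)%:E)^\-)%E x = \int[mu]_(x in A) (Num.max (- k x) 0)%:E)%E.
  by apply: eq_integral => x _; rewrite funenegE EFin_max.
by rewrite !E !E' hp hn.
Qed.

Lemma ge0_integral_affine G (a b : R) : 0 < a -> continuous G ->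
  (forall x, 0 <= G x) ->
  (\int[mu]_x (G x)%:E = \int[mu]_x (G (a * x + b) * a)%:E)%E.
Proof.
move=> a0 cG G0; pose F x := a * x + b.
have dF (x : R) : is_derive x 1 F a.
  by derive; rewrite addr0.
have dFE : F^`()%classic = cst a.
  by apply/funext => x; rewrite derive1E; exact: derive_val.
rewrite (@increasing_ge0_integration_by_substitutionT _ F G) ?dFE//.
- by move=> x y xy; rewrite /F ltrD2r ltr_pM2l.
- by move=> x; exact: cvg_cst.
- exact: is_cvg_cst.
- exact: is_cvg_cst.
- apply/cvgrNyPle => A; near=> x; rewrite /F -lerBrDr -ler_pdivlMl//.
- apply/cvgryPge => A; near=> x; rewrite /F -lerBlDr -ler_pdivrMl//.
Unshelve. all: by end_near. Qed.

Lemma integral_affine G (a b : R) : 0 < a -> continuous G ->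
  (\int[mu]_x (G x)%:E = \int[mu]_x (G (a * x + b) * a)%:E)%E.
Proof.
move=> a0 cG; apply: integral_split_eq.
- rewrite (@ge0_integral_affine _ a b)//.
  + by apply: eq_integral => x _; rewrite maxr_pMl ?mul0r// ltW.
  + exact: continuous_pos_part.
  + by move=> x; rewrite le_max lexx orbT.
- rewrite (@ge0_integral_affine _ a b)//.
  + by apply: eq_integral => x _; rewrite maxr_pMl ?mul0r ?mulNr// ltW.
  + by apply: (@continuous_pos_part (fun x => - G x)); cont.
  + by move=> x; rewrite le_max lexx orbT.
Qed.

(** Substitution is made on the compact intervals [-n, n], whose images exhaust the half-line;
    monotone convergence passes to the limit on both sides. *)
Lemma ge0_integral_exp_subst h : {in `]0, +oo[, continuous h} ->
  (forall x, 0 < x -> 0 <= h x) ->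
  (\int[mu]_(x in `]0%R, +oo[) (h x)%:E = \int[mu]_v (h (expR v) * expR v)%:E)%E.
Proof.
move=> ch h0.
have cg : continuous (fun v => h (expR v) * expR v).
  move=> v; apply: cvgM; last exact: continuous_expR.
  apply: continuous_comp; first exact: continuous_expR.
  by apply: ch; rewrite in_itv/= andbT expR_gt0.
have fin n : (\int[mu]_(x in `[expR (- n%:R), expR n%:R]) (h x)%:E =
    \int[mu]_(v in `[(- n%:R)%R, n%:R]) (h (expR v) * expR v)%:E)%E.
  have dE : (@expR R)^`()%classic = expR.
    by apply/funext => x; rewrite derive1E; exact: derive_val.
  rewrite (@integration_by_substitution_increasing _ expR h) ?dE//.
  - by rewrite (@le_trans _ _ 0)// oppr_le0.
  - by move=> x y _ _; rewrite ltr_expR.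
  - by move=> x _; exact: continuous_expR.
  - apply/cvg_ex; exists (expR (- n%:R)); apply: cvg_at_right_filter; exact: continuous_expR.
  - apply/cvg_ex; exists (expR n%:R); apply: cvg_at_left_filter; exact: continuous_expR.
  - split=> [x _||].
    + exact: derivable_expR.
    + apply: cvg_at_right_filter; exact: continuous_expR.
    + apply: cvg_at_left_filter; exact: continuous_expR.
  - apply: continuous_in_subspaceT => x; rewrite inE /= in_itv /= => /andP[xn _].
    by apply: ch; rewrite in_itv /= andbT (lt_le_trans _ xn) ?expR_gt0.
have U1 : `]0, +oo[%classic = \bigcup_n `[expR (- n%:R), expR n%:R]%classic :> set R.
  apply/seteqP; split => x /=.
    rewrite in_itv /= andbT => x0; exists (Num.trunc `|ln x|).+1 => //=.
    have : `|ln x| <= (Num.trunc `|ln x|).+1%:R by rewrite ltW// truncnS_gt.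
    by rewrite ler_norml in_itv /= -ler_expR -[X in _ && X]ler_expR lnK.
  case=> n _ /=; rewrite !in_itv /= andbT => /andP[xn _].
  by rewrite (lt_le_trans _ xn) ?expR_gt0.
have U2 : [set: R] = \bigcup_n `[(- n%:R)%R, n%:R]%classic.
  apply/seteqP; split => // x _; exists (Num.trunc `|x|).+1 => //=.
  by rewrite in_itv /= -ler_norml ltW// truncnS_gt.
have nd (u : nat -> R) : {homo u : m n / (m <= n)%N >-> m <= n} ->
    nondecreasing_seq (fun n => `[- u n, u n]%classic : set R).
  move=> uh m n mn; rewrite subsetEset => x /=; rewrite !in_itv /= -!ler_norml => /le_trans.
  by apply; exact: uh.
have mh : measurable_fun (`]0%R, +oo[%classic : set R) h.
  apply: open_continuous_measurable_fun; first exact: interval_open.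
  by move=> x; rewrite inE; exact: ch.
have c1 : (\int[mu]_(x in `[expR (- n%:R), expR n%:R]) (h x)%:E)%E @[n --> \oo] -->
    (\int[mu]_(x in `]0%R, +oo[) (h x)%:E)%E.
  rewrite U1; apply: ge0_nondecreasing_set_cvg_integral => //.
  - move=> m n mn; rewrite subsetEset => x /=; rewrite !in_itv /= => /andP[h1 h2].
    by rewrite (le_trans _ h1) ?(le_trans h2) ?ler_expR ?lerN2 ?ler_nat.
  - move=> n; apply/measurable_EFinP; apply: measurable_funS mh => // x /=.
    by rewrite !in_itv /= andbT => /andP[xn _]; rewrite (lt_le_trans _ xn) ?expR_gt0.
  - move=> n x; rewrite /= in_itv /= => /andP[xn _]; rewrite lee_fin h0//.
    by rewrite (lt_le_trans _ xn) ?expR_gt0.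
have c2 : (\int[mu]_(v in `[(- n%:R)%R, n%:R]) (h (expR v) * expR v)%:E)%E @[n --> \oo] -->
    (\int[mu]_v (h (expR v) * expR v)%:E)%E.
  rewrite U2; apply: ge0_nondecreasing_set_cvg_integral => //.
  - by apply: nd => m n; rewrite ler_nat.
  - move=> n; apply/measurable_EFinP/measurable_funTS.
    exact: continuous_measurable_fun.
  - by move=> n x _; rewrite lee_fin mulr_ge0 ?expR_ge0// h0 ?expR_gt0.
by move: c2; rewrite -(funext fin) => c2; exact: (cvg_unique _ c1 c2).
Qed.

Lemma integral_exp_subst h : {in `]0, +oo[, continuous h} ->
  (\int[mu]_(x in `]0%R, +oo[) (h x)%:E = \int[mu]_v (h (expR v) * expR v)%:E)%E.
Proof.
move=> ch.
have cpos (k : R -> R) : {in `]0, +oo[, continuous k} ->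
    {in `]0, +oo[, continuous (fun x => Num.max (k x) 0)}.
  move=> ck x x0; rewrite (funext (max0_normE k)).
  apply: cvgM; last exact: cvg_cst.
  by apply: cvgD; [exact: ck|apply: cvg_norm; exact: ck].
apply: integral_split_eq.
- rewrite ge0_integral_exp_subst.
  + by apply: eq_integral => x _; rewrite maxr_pMl ?mul0r// expR_ge0.
  + exact: cpos.
  + by move=> x _; rewrite le_max lexx orbT.
- rewrite ge0_integral_exp_subst.
  + by apply: eq_integral => x _; rewrite maxr_pMl ?mul0r ?mulNr// expR_ge0.
  + by apply: cpos => x x0; apply: cvgN; exact: ch.
  + by move=> x _; rewrite le_max lexx orbT.
Qed.

End substitutions.

(** * The complex exponential and complex-valued integrals *)

Section complex_integrals.
Context {R : realType}.
Local Notation mu := (@lebesgue_measure R).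
Implicit Types (z w c : R[i]) (g : R -> R[i]) (h : R -> R).

Lemma Re_mul z w : complex.Re (z * w) =
  complex.Re z * complex.Re w - complex.Im z * complex.Im w.
Proof. by case: z w => [a b] [c d]. Qed.

Lemma Im_mul z w : complex.Im (z * w) =
  complex.Re z * complex.Im w + complex.Im z * complex.Re w.
Proof. by case: z w => [a b] [c d]. Qed.

Lemma Re_add z w : complex.Re (z + w) = complex.Re z + complex.Re w.
Proof. by case: z w => [a b] [c d]. Qed.

Lemma Im_add z w : complex.Im (z + w) = complex.Im z + complex.Im w.
Proof. by case: z w => [a b] [c d]. Qed.

Lemma Re_opp z : complex.Re (- z) = - complex.Re z.
Proof. by case: z. Qed.

Lemma Im_opp z : complex.Im (- z) = - complex.Im z.
Proof. by case: z. Qed.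

Lemma complex_ext z w :
  complex.Re z = complex.Re w -> complex.Im z = complex.Im w -> z = w.
Proof. by case: z w => [a b] [c d] /= -> ->. Qed.

Lemma normc_sqr z : Normc.normc z ^+ 2 = complex.Re z ^+ 2 + complex.Im z ^+ 2.
Proof. by case: z => a b /=; rewrite sqr_sqrtr ?addr_ge0 ?sqr_ge0. Qed.

Lemma normc_ge0 z : 0 <= Normc.normc z.
Proof. by case: z => a b; exact: sqrtr_ge0. Qed.

Lemma Re_le_normc z : `|complex.Re z| <= Normc.normc z.
Proof.
rewrite -ler_sqr ?nnegrE ?normc_ge0// normc_sqr real_normK ?num_real//.
by rewrite lerDl sqr_ge0.
Qed.

Lemma Im_le_normc z : `|complex.Im z| <= Normc.normc z.
Proof.
rewrite -ler_sqr ?nnegrE ?normc_ge0// normc_sqr real_normK ?num_real//.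
by rewrite lerDr sqr_ge0.
Qed.

Lemma normc_real (x : R) : Normc.normc x%:C = `|x|.
Proof. by rewrite /= expr0n /= addr0 sqrtr_sqr. Qed.

Lemma Re_cexp z : complex.Re (cexp z) = expR (complex.Re z) * cos (complex.Im z).
Proof. by rewrite /cexp Re_mul /= mul0r subr0. Qed.

Lemma Im_cexp z : complex.Im (cexp z) = expR (complex.Re z) * sin (complex.Im z).
Proof. by rewrite /cexp Im_mul /= mul0r addr0. Qed.

Lemma cexpD z w : cexp (z + w) = cexp z * cexp w.
Proof.
by apply: complex_ext; rewrite !(Re_mul, Im_mul, Re_cexp, Im_cexp, Re_add, Im_add)
  expRD ?cosD ?sinD; ring.
Qed.

Lemma cexp_real (x : R) : cexp x%:C = (expR x)%:C.
Proof.
by apply: complex_ext; rewrite ?Re_cexp ?Im_cexp /= ?cos0 ?sin0 ?mulr1 ?mulr0.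
Qed.

Lemma normc_cexp z : Normc.normc (cexp z) = expR (complex.Re z).
Proof.
apply/eqP; rewrite -(@eqrXn2 _ 2) ?normc_ge0 ?expR_ge0//.
by rewrite normc_sqr Re_cexp Im_cexp !exprMn -mulrDr cos2Dsin2 mulr1.
Qed.

Lemma Re_mulr z (x : R) : complex.Re (z * x%:C) = complex.Re z * x.
Proof. by rewrite Re_mul /= mulr0 subr0. Qed.

Lemma Im_mulr z (x : R) : complex.Im (z * x%:C) = complex.Im z * x.
Proof. by rewrite Im_mul /= mulr0 add0r. Qed.

Definition cint g : R[i] :=
  (\int[mu]_x complex.Re (g x)) +i* (\int[mu]_x complex.Im (g x)).

Definition cintegrable g : Prop :=
  mu.-integrable setT (EFin \o (fun x => complex.Re (g x))) /\
  mu.-integrable setT (EFin \o (fun x => complex.Im (g x))).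

Lemma cintegrable_scale c g :
  cintegrable g -> cintegrable (fun x => c * g x).
Proof.
case=> rg ig; split.
- have := integrable_add (integrable_scale (complex.Re c) rg)
    (integrable_scale (- complex.Im c) ig).
  by apply: eq_integrable => // x _ /=; rewrite Re_mul mulNr.
- have := integrable_add (integrable_scale (complex.Re c) ig)
    (integrable_scale (complex.Im c) rg).
  by apply: eq_integrable => // x _ /=; rewrite Im_mul.
Qed.

Lemma cint_scale c g : cintegrable g -> cint (fun x => c * g x) = c * cint g.
Proof.
case=> rg ig; apply: complex_ext => /=.
- rewrite Re_mul /= -!RintegralZl// -RintegralB//; last 2 first.
  + exact: integrable_scale.
  + exact: integrable_scale.
  by apply: eq_Rintegral => x _; rewrite Re_mul.
- rewrite Im_mul /= -!RintegralZl// -RintegralD//; last 2 first.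
  + exact: integrable_scale.
  + exact: integrable_scale.
  by apply: eq_Rintegral => x _; rewrite Im_mul.
Qed.

Lemma cintegrable_dominated g h :
  measurable_fun setT (fun x => complex.Re (g x)) ->
  measurable_fun setT (fun x => complex.Im (g x)) ->
  (forall x, Normc.normc (g x) <= h x) -> mu.-integrable setT (EFin \o h) ->
  cintegrable g.
Proof.
move=> mr mi gh ih; split; apply: integrable_dominated ih => // x.
  exact: le_trans (Re_le_normc _) _.
exact: le_trans (Im_le_normc _) _.
Qed.

(* Multiply by the conjugate of the integral, so as to make it real. *)
Lemma normc_cint_le g h : cintegrable g -> (forall x, Normc.normc (g x) <= h x) ->
  mu.-integrable setT (EFin \o h) -> Normc.normc (cint g) <= \int[mu]_x h x.
Proof.
move=> ig gh ih; set Z := cint g.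
have h0 : 0 <= \int[mu]_x h x.
  by apply: Rintegral_ge0 => x _; exact: le_trans (normc_ge0 _) (gh x).
have [->//|Z0] := eqVneq (Normc.normc Z) 0.
have Zp : 0 < Normc.normc Z by rewrite lt_def Z0 normc_ge0.
rewrite -(ler_pM2l Zp) -expr2 normc_sqr.
have -> : complex.Re Z ^+ 2 + complex.Im Z ^+ 2 = complex.Re (conjc Z * Z).
  by case: (Z) => a b /=; ring.
have nJ : Normc.normc (conjc Z) = Normc.normc Z by case: (Z) => a b /=; rewrite sqrrN.
rewrite -cint_scale//= -RintegralZl//; apply: le_Rintegral => //.
- exact: (cintegrable_scale _ ig).1.
- exact: integrable_scale.
- move=> x _; apply: le_trans (ler_norm _) _; apply: le_trans (Re_le_normc _) _.
  by rewrite Normc.normcM nJ ler_wpM2l ?normc_ge0.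
Qed.

Lemma eq_cint g g' : g =1 g' -> cint g = cint g'.
Proof. by move=> gg'; congr cint; apply/funext. Qed.

End complex_integrals.

(** * The Gamma function on the right half-plane *)

Section gamma_function.
Context {R : realType}.
Local Notation mu := (@lebesgue_measure R).
Implicit Types (z w : R[i]) (u v y r : R).

(* Euler's integral after the substitution x = exp r. *)
Definition gamma_kernel w r : R[i] := cexp (w * r%:C) * (expR (- expR r))%:C.

Lemma Re_gamma_kernel w r : complex.Re (gamma_kernel w r) =
  expR (complex.Re w * r) * cos (complex.Im w * r) * expR (- expR r).
Proof. by rewrite Re_mulr Re_cexp Re_mulr Im_mulr. Qed.

Lemma Im_gamma_kernel w r : complex.Im (gamma_kernel w r) =
  expR (complex.Re w * r) * sin (complex.Im w * r) * expR (- expR r).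
Proof. by rewrite Im_mulr Im_cexp Re_mulr Im_mulr. Qed.

Lemma normc_gamma_kernel w r :
  Normc.normc (gamma_kernel w r) = expR (complex.Re w * r) * expR (- expR r).
Proof.
by rewrite Normc.normcM normc_cexp normc_real ger0_norm ?expR_ge0// Re_mulr.
Qed.

(** For r < 0 the factor exp(u r) decays by itself. For r >= 0, exp r >= r^2 / 2, and (u + 1)^2 / 2
    is the maximum of (u + 1) r - r^2 / 2; the extra 1 pays for the decay in |r|. *)
Lemma gamma_kernel_bound u r : 0 < u ->
  expR (u * r) * expR (- expR r) <=
    expR ((u + 1) ^+ 2 / 2) * expR (- (Num.min u 1 * `|r|)).
Proof.
move=> u0; rewrite -!expRD ler_expR.
have [r0|r0] := leP 0 r.
- rewrite ger0_norm//.
  have : Num.min u 1 * r <= r by rewrite ler_piMl// ge_min lexx orbT.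
  have := expR_ge1Dxn 1 r0; rewrite (_ : 2`!%:R = 2)//.
  have : 0 <= (r - (u + 1)) ^+ 2 by exact: sqr_ge0.
  nra.
- rewrite ltr0_norm//.
  have : Num.min u 1 * (- r) <= u * (- r).
    by rewrite ler_wpM2r ?oppr_ge0 ?(ltW r0)// ge_min lexx.
  have := expR_gt0 r; have := sqr_ge0 (u + 1); lra.
Qed.

Lemma integrable_gamma_kernel u : 0 < u ->
  mu.-integrable setT (EFin \o (fun r => expR (u * r) * expR (- expR r))).
Proof.
move=> u0.
apply: (@integrable_dominated _ _
  (fun r => expR ((u + 1) ^+ 2 / 2) * expR (- (Num.min u 1 * `|r|)))).
- by apply: continuous_measurable_fun; cont.
- by move=> r; rewrite ger0_norm ?mulr_ge0 ?expR_ge0//; exact: gamma_kernel_bound.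
- by apply/integrable_scale/integrable_expR_norm; rewrite lt_min u0 ltr01.
Qed.

Lemma continuous_Re_gamma_kernel w : continuous (fun r => complex.Re (gamma_kernel w r)).
Proof. by rewrite (funext (Re_gamma_kernel w)); cont. Qed.

Lemma continuous_Im_gamma_kernel w : continuous (fun r => complex.Im (gamma_kernel w r)).
Proof. by rewrite (funext (Im_gamma_kernel w)); cont. Qed.

Lemma cintegrable_gamma_kernel w : 0 < complex.Re w -> cintegrable (gamma_kernel w).
Proof.
move=> u0; apply: (cintegrable_dominated _ _ _ (integrable_gamma_kernel u0)).
- apply: continuous_measurable_fun; exact: continuous_Re_gamma_kernel.
- apply: continuous_measurable_fun; exact: continuous_Im_gamma_kernel.
- by move=> r; rewrite normc_gamma_kernel.
Qed.

Lemma gamma_integral_line z : gamma_integral z = cint (gamma_kernel z).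
Proof.
have cln (x : R) : x \in `]0, +oo[ -> {for x, continuous (@ln R)}.
  by rewrite in_itv /= andbT; exact: continuous_ln.
have cnts (F : R -> R) (x : R) : continuous F -> x \in `]0, +oo[ ->
    {for x, continuous (fun x => F (ln x))}.
  by move=> cF x0; apply: continuous_comp; [exact: cln|exact: cF].
have cE : continuous (fun x : R => expR (- x)) by cont.
have kE v : gamma_integrand z (expR v) * (expR v)%:C = gamma_kernel z v.
  rewrite /gamma_integrand /cpow /gamma_kernel expRK mulrAC.
  by rewrite -(cexp_real v) -cexpD; congr (cexp _ * _); ring.
rewrite /gamma_integral /cint /Rintegral; congr (fine _ +i* fine _).
- rewrite integral_exp_subst.
    by apply: eq_integral => v _; rewrite -kE [in RHS]Re_mulr.
  have -> : (fun x => complex.Re (gamma_integrand z x)) = (fun x =>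
      expR (complex.Re (z - 1) * ln x) * cos (complex.Im (z - 1) * ln x) * expR (- x)).
    apply/funext => x; rewrite /gamma_integrand /cpow.
    by rewrite Re_mulr Re_cexp Re_mulr Im_mulr.
  move=> x x0; apply: cvgM; last exact: cE.
  apply: (cnts (fun l =>
    expR (complex.Re (z - 1) * l) * cos (complex.Im (z - 1) * l))) => //.
  by cont.
- rewrite integral_exp_subst.
    by apply: eq_integral => v _; rewrite -kE [in RHS]Im_mulr.
  have -> : (fun x => complex.Im (gamma_integrand z x)) = (fun x =>
      expR (complex.Re (z - 1) * ln x) * sin (complex.Im (z - 1) * ln x) * expR (- x)).
    apply/funext => x; rewrite /gamma_integrand /cpow.
    by rewrite Im_mulr Im_cexp Re_mulr Im_mulr.
  move=> x x0; apply: cvgM; last exact: cE.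
  apply: (cnts (fun l =>
    expR (complex.Re (z - 1) * l) * sin (complex.Im (z - 1) * l))) => //.
  by cont.
Qed.

(** Here 1 - Re w < 1, so no unit shift takes place. Every Gamma value met on a separating line has
    its argument in this half-plane. *)
Lemma Gamma_line w : 0 < complex.Re w -> Gamma w = cint (gamma_kernel w).
Proof.
move=> w0; rewrite /Gamma.
have -> : gamma_shift w = 0%N.
  by apply/truncn0Pn; rewrite -ltNge; lra.
by rewrite big_ord0 divr1 addr0 gamma_integral_line.
Qed.

Let cvg_gamma_kernel0 u : 0 < u ->
  (expR (u * n%:R) * expR (- expR n%:R) @[n --> \oo] --> (0 : R)) /\
  (expR (u * - n%:R) * expR (- expR (- n%:R)) @[n --> \oo] --> (0 : R)).
Proof.
move=> u0; have m0 : 0 < Num.min u 1 by rewrite lt_min u0 ltr01.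
have c0 : expR ((u + 1) ^+ 2 / 2) * expR (- (Num.min u 1 * n%:R)) @[n --> \oo] --> (0 : R).
  rewrite -[X in _ --> X](mulr0 (expR ((u + 1) ^+ 2 / 2))).
  apply: cvgM; first exact: cvg_cst.
  apply: (@cvg_comp _ _ _ (fun n => n%:R) (fun x => expR (- (Num.min u 1 * x))) _ +oo_R).
    exact: cvgr_idn.
  apply: (@cvg_comp _ _ _ (fun x => Num.min u 1 * x) (fun x => expR (- x)) _ +oo_R).
    exact: (gt0_cvgMry m0 cvg_id).
  exact: cvgr_expR.
split; apply: squeeze_cvgr (cvg_cst 0) c0; apply: nearW => n;
  rewrite mulr_ge0 ?expR_ge0//=; apply: le_trans (gamma_kernel_bound _ u0) _;
  by rewrite ?normrN ger0_norm.
Qed.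

(* [r |-> cexp (w r) exp (- exp r)] vanishes at both ends, and its derivative is
   [w] times the kernel at [w] minus the kernel at [w + 1]. *)
Lemma gamma_functional_equation w : 0 < complex.Re w ->
  cint (gamma_kernel (w + 1)) = w * cint (gamma_kernel w).
Proof.
move=> w0; set u := complex.Re w; set y := complex.Im w.
have w10 : 0 < complex.Re (w + 1) by rewrite Re_add /= addr_gt0.
have [r0 i0] := cintegrable_gamma_kernel w0.
have [r1 i1] := cintegrable_gamma_kernel w10.
have [cp cn] := cvg_gamma_kernel0 w0.
have Re1 r : complex.Re (gamma_kernel (w + 1) r) = expR r * complex.Re (gamma_kernel w r).
  rewrite !Re_gamma_kernel Re_add Im_add /= addr0 mulrDl mul1r expRD; ring.
have Im1 r : complex.Im (gamma_kernel (w + 1) r) = expR r * complex.Im (gamma_kernel w r).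
  rewrite !Im_gamma_kernel Re_add Im_add /= addr0 mulrDl mul1r expRD; ring.
have vanish (F : R -> R) : (forall r, `|F r| <= expR (u * r) * expR (- expR r)) ->
    (F n%:R @[n --> \oo] --> (0 : R)) /\ (F (- n%:R) @[n --> \oo] --> (0 : R)).
  move=> hF; split; apply/norm_cvg0P.
    by apply: squeeze_cvgr (cvg_cst 0) cp; apply: nearW => n; rewrite normr_ge0 hF.
  by apply: squeeze_cvgr (cvg_cst 0) cn; apply: nearW => n; rewrite normr_ge0 hF.
have cr := @continuous_Re_gamma_kernel w.
have ci := @continuous_Im_gamma_kernel w.
have cr1 := @continuous_Re_gamma_kernel (w + 1).
have ci1 := @continuous_Im_gamma_kernel (w + 1).
have hR r : `|complex.Re (gamma_kernel w r)| <= expR (u * r) * expR (- expR r).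
  by rewrite -normc_gamma_kernel; exact: Re_le_normc.
have hI r : `|complex.Im (gamma_kernel w r)| <= expR (u * r) * expR (- expR r).
  by rewrite -normc_gamma_kernel; exact: Im_le_normc.
(* Common form of the real and imaginary parts: integrate a' = u a + k b - c, where a vanishes at
   both ends. It is used with k = -y for the real part and k = y for the imaginary part. *)
have dk (a b c : R -> R) k : mu.-integrable setT (EFin \o a) ->
    mu.-integrable setT (EFin \o b) -> mu.-integrable setT (EFin \o c) ->
    continuous a -> continuous b -> continuous c ->
    (forall r : R, is_derive r 1 a (u * a r + (k * b r + - c r))) ->
    (forall r, `|a r| <= expR (u * r) * expR (- expR r)) ->
    \int[mu]_r c r = u * \int[mu]_r a r + k * \int[mu]_r b r.
  move=> ia ib ic ca cb cc da /vanish[cF cF'].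
  have iN : mu.-integrable setT (EFin \o (fun r => - c r)).
    have := integrable_scale (-1) ic.
    by apply: eq_integrable => // x _ /=; rewrite mulN1r.
  have i2 := integrable_add (integrable_scale k ib) iN.
  have := integral_derive_line _ da (integrable_add (integrable_scale u ia) i2) cF cF'.
  rewrite subrr (RintegralD measurableT (integrable_scale u ia) i2).
  rewrite (RintegralD measurableT (integrable_scale k ib) iN) !RintegralZl//.
  have -> : \int[mu]_r (- c r) = - \int[mu]_r c r.
    by under eq_Rintegral do rewrite -mulN1r; rewrite RintegralZl// mulN1r.
  move=> h; have {h} := h _; rewrite addrA => h; apply/esym/eqP; rewrite -subr_eq0 h//.
  by cont.
apply: complex_ext; rewrite ?Re_mul ?Im_mul -/u -/y.
- notypeclasses refine (etrans (dk _ _ _ (- y) r0 i0 r1 cr ci cr1 _ hR) _);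
    last by rewrite mulNr.
  move=> r.
  rewrite Re1 (funext (Re_gamma_kernel w)) !Re_gamma_kernel Im_gamma_kernel -/u -/y.
  by derive => /=; ring.
- notypeclasses refine (dk _ _ _ y i0 r0 i1 ci cr ci1 _ hI).
  move=> r.
  rewrite Im1 (funext (Im_gamma_kernel w)) !Im_gamma_kernel Re_gamma_kernel -/u -/y.
  by derive => /=; ring.
Qed.

End gamma_function.

(** * Upper and lower bounds for the modulus of Gamma *)

Section gamma_bounds.
Context {R : realType}.
Local Notation mu := (@lebesgue_measure R).
Implicit Types (w : R[i]) (u v y r : R).

(** The Gamma function on the positive reals, which is also the bound on |Gamma w| obtained by
    taking absolute values under the integral. *)
Definition gammaR u : R := \int[mu]_r (expR (u * r) * expR (- expR r)).

Lemma Rintegral0 (g : R -> R) : (forall x, g x = 0) -> \int[mu]_x g x = 0.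
Proof.
by move=> g0; rewrite /Rintegral integral0_eq// => x _; rewrite g0.
Qed.

Lemma cint_gamma_kernel_real u : cint (gamma_kernel u%:C) = (gammaR u)%:C.
Proof.
rewrite /cint /gammaR; congr (_ +i* _).
- by apply: eq_Rintegral => r _; rewrite Re_gamma_kernel /= mul0r cos0 mulr1.
- by apply: Rintegral0 => r; rewrite Im_gamma_kernel /= mul0r sin0 mulr0 mul0r.
Qed.

Lemma gammaR_gt0 u : 0 < u -> 0 < gammaR u.
Proof.
move=> u0; have ig := integrable_gamma_kernel u0.
have ig' : mu.-integrable `[0, 1]%classic
    (EFin \o (fun r : R => expR (u * r) * expR (- expR r))).
  by apply: integrableS ig => //; exact: measurable_itv.
(* This is a lower bound of the integrand on [0, 1], an interval of length 1. *)
apply: (@lt_le_trans _ _ (expR (- expR 1))); first exact: expR_gt0.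
have -> : expR (- expR 1) = \int[mu]_(r in `[0%R, 1%R]) (expR (- expR 1) : R).
  rewrite Rintegral_cst//= lebesgue_measure_itv /= lte_fin ltr01.
  by rewrite -EFinB /= subr0 mulr1.
apply: (@le_trans _ _ (\int[mu]_(r in `[0%R, 1%R]) (expR (u * r) * expR (- expR r)))).
  apply: le_Rintegral => //.
  - apply: continuous_compact_integrable; first exact: segment_compact.
    by apply: continuous_subspaceT => x; exact: cvg_cst.
  - move=> r /=; rewrite in_itv /= => /andP[r0 r1].
    rewrite -[leLHS]mul1r ler_pM ?expR_ge0// ?ler_expR ?lerN2 ?ler_expR//.
    by rewrite -expR0 ler_expR mulr_ge0// ltW.
rewrite /gammaR /Rintegral fine_le ?(integrable_fin_num _ ig) ?(integrable_fin_num _ ig')//.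
by apply: ge0_subset_integral => //; case/integrableP: ig.
Qed.

Lemma gammaRS u : 0 < u -> gammaR (u + 1) = u * gammaR u.
Proof.
move=> u0; apply: complexI; rewrite -(cint_gamma_kernel_real (u + 1)) rmorphD rmorph1.
by rewrite (gamma_functional_equation (w := u%:C))// cint_gamma_kernel_real rmorphM.
Qed.

Lemma normc_gamma_le w : 0 < complex.Re w ->
  Normc.normc (cint (gamma_kernel w)) <= gammaR (complex.Re w).
Proof.
move=> w0; apply: normc_cint_le.
- exact: cintegrable_gamma_kernel.
- by move=> r; rewrite normc_gamma_kernel.
- exact: integrable_gamma_kernel.
Qed.

(* A Gamma variable of large parameter v concentrates around v, so that
   [x ^ (i y)] stays close to the unit complex number [v ^ (i y)] on average. *)
Lemma normc_gamma_ge w : 1 < complex.Re w ->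
  complex.Im w ^+ 2 <= complex.Re w - 1 ->
  gammaR (complex.Re w) / 2 <= Normc.normc (cint (gamma_kernel w)).
Proof.
set v := complex.Re w; set y := complex.Im w => v1 yv.
have v0 : 0 < v by rewrite (lt_trans _ v1).
have v10 : 0 < v - 1 by rewrite subr_gt0.
(* Rotating by v^(-i y) turns the phase of the kernel into y (r - ln v), which vanishes at the point
   of concentration r = ln v. *)
pose c : R[i] := cexp (0 +i* (- (y * ln v))).
have <- : Normc.normc (c * cint (gamma_kernel w)) = Normc.normc (cint (gamma_kernel w)).
  by rewrite Normc.normcM normc_cexp /= expR0 mul1r.
have ic := cintegrable_gamma_kernel v0.
rewrite -cint_scale//; apply: le_trans (le_trans (ler_norm _) (Re_le_normc _)) => /=.
have i0 := integrable_gamma_kernel v0.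
have i1 : mu.-integrable setT (EFin \o (fun r => expR ((v + 1) * r) * expR (- expR r))).
  by apply: integrable_gamma_kernel; rewrite addr_gt0.
have i2 := integrable_gamma_kernel v10.
(* The minorant comes from cos x >= 1 - x^2 / 2 and (r - ln v)^2 <= exp r / v + v / exp r - 2. The
   factors exp r and exp(-r) move the parameter of the kernel to v + 1 and v - 1. *)
have iD := integrable_add (integrable_scale (1 + y ^+ 2) i0)
  (integrable_add (integrable_scale (- (y ^+ 2 / (2 * v))) i1)
                  (integrable_scale (- (y ^+ 2 * v / 2)) i2)).
apply: (@le_trans _ _ (\int[mu]_r ((1 + y ^+ 2) * (expR (v * r) * expR (- expR r)) +
   (- (y ^+ 2 / (2 * v)) * (expR ((v + 1) * r) * expR (- expR r)) +
    - (y ^+ 2 * v / 2) * (expR ((v - 1) * r) * expR (- expR r)))))); last first.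
  apply: (le_Rintegral measurableT iD (cintegrable_scale c ic).1).
  move=> r _; rewrite Re_mul Re_gamma_kernel Im_gamma_kernel Re_cexp Im_cexp /= -/v -/y.
  rewrite expR0 !mul1r.
  have -> : cos (- (y * ln v)) * (expR (v * r) * cos (y * r) * expR (- expR r)) -
      sin (- (y * ln v)) * (expR (v * r) * sin (y * r) * expR (- expR r)) =
      (expR (v * r) * expR (- expR r)) * cos (- (y * ln v) + y * r).
    by rewrite cosD; ring.
  have E0 : 0 <= expR (v * r) * expR (- expR r) by rewrite mulr_ge0 ?expR_ge0.
  have := cos_ge_parabola (- (y * ln v) + y * r).
  have := sqr_le_cosh (r - ln v).
  rewrite opprB !expRB lnK ?posrE// => hc hp.
  have -> : expR ((v + 1) * r) = expR (v * r) * expR r by rewrite mulrDl mul1r expRD.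
  have -> : expR ((v - 1) * r) = expR (v * r) / expR r by rewrite mulrBl mul1r expRB.
  have : y ^+ 2 * (r - ln v) ^+ 2 <= y ^+ 2 * (expR r / v + v / expR r - 2).
    by rewrite ler_wpM2l ?sqr_ge0.
  move=> hy; apply: (@le_trans _ _ ((expR (v * r) * expR (- expR r)) *
     (1 - y ^+ 2 * (expR r / v + v / expR r - 2) / 2))).
    rewrite le_eqVlt; apply/orP; left; apply/eqP; field.
    by apply/andP; split; apply: lt0r_neq0; [exact: expR_gt0|exact: v0].
  rewrite ler_wpM2l//; apply: le_trans hp.
  have -> : (- (y * ln v) + y * r) ^+ 2 = y ^+ 2 * (r - ln v) ^+ 2 by ring.
  lra.
rewrite (RintegralD measurableT (integrable_scale _ i0)
  (integrable_add (integrable_scale _ i1) (integrable_scale _ i2))).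
rewrite (RintegralD measurableT (integrable_scale _ i1) (integrable_scale _ i2)).
rewrite !RintegralZl// -!/(gammaR _) gammaRS//.
have -> : gammaR v = (v - 1) * gammaR (v - 1) by rewrite -gammaRS// subrK.
have g0 := gammaR_gt0 v10.
(* With all three values expressed by [gammaR (v - 1)], the margin over half of [gammaR v] is a
   positive multiple of v - 1 - y^2, hence the hypothesis on the imaginary part. *)
rewrite -subr_ge0 (_ : _ - _ = gammaR (v - 1) / 2 * (v - 1 - y ^+ 2)).
  by rewrite mulr_ge0 ?divr_ge0 ?subr_ge0// ltW.
by field; rewrite gt_eqF.
Qed.

Lemma gamma_shiftn w N : 0 < complex.Re w ->
  cint (gamma_kernel (w + N%:R)) =
  (\prod_(k < N) (w + k%:R)) * cint (gamma_kernel w).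
Proof.
move=> w0; elim: N => [|N IH]; first by rewrite big_ord0 mul1r addr0.
have wN : 0 < complex.Re (w + N%:R).
  by rewrite Re_add -(rmorph_nat (real_complex R)) /= ltr_wpDr.
by rewrite big_ord_recr /= -natr1 addrA gamma_functional_equation// IH mulrCA mulrA.
Qed.

(** A zero at w would propagate to w + N by the functional equation, but for N > y^2 + 1 the lower
    bound excludes it. *)
Lemma gamma_neq0 w : 0 < complex.Re w -> cint (gamma_kernel w) != 0.
Proof.
move=> w0; pose N := (Num.truncn (complex.Im w ^+ 2)).+2.
have hN : complex.Im w ^+ 2 <= N%:R - 1.
  by rewrite -natr1 addrK ltW// truncnS_gt.
have RN : complex.Re (w + N%:R) = complex.Re w + N%:R.
  by rewrite Re_add -(rmorph_nat (real_complex R)).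
have IN : complex.Im (w + N%:R) = complex.Im w.
  by rewrite Im_add -(rmorph_nat (real_complex R)) /= addr0.
have N1 : 1 <= N%:R :> R by rewrite ler1n.
have := @normc_gamma_ge (w + N%:R); rewrite RN IN.
have h1 : 1 < complex.Re w + N%:R by lra.
have h2 : complex.Im w ^+ 2 <= complex.Re w + N%:R - 1 by lra.
move=> /(_ h1 h2); rewrite gamma_shiftn//; apply: contraTneq => ->.
rewrite mulr0 Normc.normc0 -ltNge divr_gt0// gammaR_gt0//; lra.
Qed.

End gamma_bounds.

(** * Affine substitutions and exchange of integrals *)

Section affine_and_fubini.
Context {R : realType}.
Local Notation mu := (@lebesgue_measure R).
Implicit Types (G : R -> R) (g : R -> R[i]).

Lemma integrable_affine G (a b : R) : 0 < a -> continuous G ->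
  mu.-integrable setT (EFin \o G) ->
  mu.-integrable setT (EFin \o (fun x => G (a * x + b))).
Proof.
move=> a0 cG iG.
have caff : continuous (fun x => a * x + b) by cont.
have cGa : continuous (fun x => G (a * x + b)) by exact: continuous_comp_fun cG caff.
have : mu.-integrable setT (EFin \o (fun x => `|G (a * x + b)| * a)).
  apply: integrable_ge0.
  - by apply: continuous_measurable_fun; cont.
  - by move=> x; rewrite mulr_ge0// ltW.
  - rewrite -(@ge0_integral_affine _ (fun x => `|G x|))//; last by cont.
    by case/integrableP: (integrable_norm iG) => _; under eq_integral do rewrite /= normr_id.
move/(integrable_scale a^-1) => h; apply: (integrable_dominated _ _ h).
  exact: continuous_measurable_fun.
by move=> x; rewrite mulrCA mulVf ?mulr1// gt_eqF.
Qed.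

Lemma Rintegral_affine G (a b : R) : 0 < a -> continuous G ->
  mu.-integrable setT (EFin \o G) ->
  \int[mu]_x G (a * x + b) = a^-1 * \int[mu]_x G x.
Proof.
move=> a0 cG iG.
have -> : \int[mu]_x G x = \int[mu]_x (G (a * x + b) * a).
  by rewrite /Rintegral (integral_affine b a0 cG).
rewrite RintegralZr//; last exact: integrable_affine.
by rewrite mulrCA mulVf ?mulr1// gt_eqF.
Qed.

Lemma cintegrable_affine g (a b : R) : 0 < a ->
  continuous (fun x => complex.Re (g x)) -> continuous (fun x => complex.Im (g x)) ->
  cintegrable g -> cintegrable (fun x => g (a * x + b)).
Proof.
move=> a0 cr ci [ir ii]; split.
- exact: (integrable_affine b a0 cr ir).
- exact: (integrable_affine b a0 ci ii).
Qed.

Lemma cint_affine g (a b : R) : 0 < a ->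
  continuous (fun x => complex.Re (g x)) -> continuous (fun x => complex.Im (g x)) ->
  cintegrable g -> cint (fun x => g (a * x + b)) = (a^-1)%:C * cint g.
Proof.
move=> a0 cr ci [ir ii]; apply: complex_ext; rewrite ?Re_mul ?Im_mul /= mul0r ?subr0 ?addr0.
- exact: (Rintegral_affine b a0 cr ir).
- exact: (Rintegral_affine b a0 ci ii).
Qed.

Lemma cintegrable_real G : mu.-integrable setT (EFin \o G) ->
  cintegrable (fun x => (G x)%:C).
Proof. by move=> iG; split; [exact: iG|exact: integrable0]. Qed.

Lemma cint_real G : cint (fun x => (G x)%:C) = (\int[mu]_x G x)%:C.
Proof. by rewrite /cint; congr (_ +i* _); exact: Rintegral0. Qed.

Lemma Rintegral_swap (f : R -> R -> R) :
  (mu \x mu)%E.-integrable setT (fun z => (f z.1 z.2)%:E) ->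
  (forall x, mu.-integrable setT (EFin \o f x)) ->
  (forall y, mu.-integrable setT (EFin \o f^~ y)) ->
  \int[mu]_x \int[mu]_y f x y = \int[mu]_y \int[mu]_x f x y.
Proof.
move=> i_f i1 i2; rewrite /Rintegral; congr fine.
under eq_integral do rewrite fineK ?(integrable_fin_num _ (i1 _))//.
under [RHS]eq_integral do rewrite fineK ?(integrable_fin_num _ (i2 _))//.
exact: (Fubini i_f).
Qed.

(** The finite iterated integral of F gives joint integrability by Tonelli. The slices are required
    to be integrable at every point, so that the inner real-valued integrals coincide with the
    extended ones. *)
Lemma Rintegral_swap_dominated (k F : R -> R -> R) :
  measurable_fun setT (fun z : R * R => k z.1 z.2) ->
  measurable_fun setT (fun z : R * R => F z.1 z.2) ->
  (forall x y, `|k x y| <= F x y) ->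
  (forall x, mu.-integrable setT (EFin \o F x)) ->
  (forall y, mu.-integrable setT (EFin \o F^~ y)) ->
  (\int[mu]_x \int[mu]_y (F x y)%:E < +oo)%E ->
  \int[mu]_x \int[mu]_y k x y = \int[mu]_y \int[mu]_x k x y.
Proof.
move=> mk mF kF i1 i2 fin.
have F0 x y : 0 <= F x y by exact: le_trans (normr_ge0 _) (kF x y).
have iF : (mu \x mu)%E.-integrable setT (fun z : R * R => (F z.1 z.2)%:E).
  apply/integrable12ltyP; first exact/measurable_EFinP.
  by under eq_integral do under eq_integral do rewrite /= ger0_norm//.
apply: Rintegral_swap.
- apply: (le_integrable _ _ _ iF) => //; first exact/measurable_EFinP.
  by move=> z _; rewrite /= lee_fin (le_trans (kF _ _))// ler_norm.
- move=> x; apply: (integrable_dominated _ (kF x) (i1 x)).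
  exact: (measurableT_comp mk (pair1_measurable x)).
- move=> y; apply: (integrable_dominated _ (kF^~ y) (i2 y)).
  exact: (measurableT_comp mk (pair2_measurable y)).
Qed.

Lemma cint_swap (H : R -> R -> R[i]) (F : R -> R -> R) :
  measurable_fun setT (fun z : R * R => complex.Re (H z.1 z.2)) ->
  measurable_fun setT (fun z : R * R => complex.Im (H z.1 z.2)) ->
  measurable_fun setT (fun z : R * R => F z.1 z.2) ->
  (forall x y, Normc.normc (H x y) <= F x y) ->
  (forall x, mu.-integrable setT (EFin \o F x)) ->
  (forall y, mu.-integrable setT (EFin \o F^~ y)) ->
  (\int[mu]_x \int[mu]_y (F x y)%:E < +oo)%E ->
  cint (fun x => cint (H x)) = cint (fun y => cint (H^~ y)).
Proof.
move=> mr mi mF HF i1 i2 fin.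
apply: complex_ext => /=; apply: (Rintegral_swap_dominated _ mF) => // x y.
  exact: le_trans (Re_le_normc _) _.
exact: le_trans (Im_le_normc _) _.
Qed.

End affine_and_fubini.

(** * The Mellin transform of the stable law *)

Section mellin_transform.
Context {R : realType}.
Local Notation mu := (@lebesgue_measure R).
Implicit Types (beta t u v r : R) (p : R -> R) (w : R[i]).

(* [p] is a density of log X, where E exp (- s X) = exp (- t s ^ beta);
   the Laplace variable is s = exp r. *)
Definition stable_log_density beta t p : Prop :=
  [/\ continuous p, forall v, 0 <= p v &
    forall r, (\int[mu]_v (expR (- expR (r + v)) * p v)%:E =
               (expR (- (t * expR (beta * r))))%:E)%E].

(* E X ^ (- w) *)
Definition mellin p w : R[i] :=
  cint (fun v => cexp (- (w * v%:C)) * (p v)%:C).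

(** With s = exp r and X = exp v, this is the modulus of s^(w-1) e^(-s X) ds against the law of ln
    X, for u = Re w. *)
Let F p u r v : R := expR (u * r) * (expR (- expR (r + v)) * p v).

Let measurable_1 (k : R -> R) : continuous k ->
  measurable_fun setT (fun z : R * R => k z.1).
Proof.
by move=> ck; exact: (measurableT_comp (continuous_measurable_fun ck) measurable_fst).
Qed.

Let measurable_2 (k : R -> R) : continuous k ->
  measurable_fun setT (fun z : R * R => k z.2).
Proof.
by move=> ck; exact: (measurableT_comp (continuous_measurable_fun ck) measurable_snd).
Qed.

Let measurable_12 (k : R -> R) : continuous k ->
  measurable_fun setT (fun z : R * R => k (z.1 + z.2)).
Proof.
move=> ck; exact: (measurableT_comp (continuous_measurable_fun ck)
  (measurable_funD measurable_fst measurable_snd)).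
Qed.

Let measurable_F p u : continuous p -> measurable_fun setT (fun z : R * R => F p u z.1 z.2).
Proof.
move=> cp; apply: measurable_funM.
  by apply: (measurable_1 (k := fun r => expR (u * r))); cont.
apply: measurable_funM; last exact: measurable_2.
by apply: (measurable_12 (k := fun r => expR (- expR r))); cont.
Qed.

(** Translating r by v separates the variables. The factor [1 *] gives the argument the form a r + b
    of the affine substitution. *)
Let F_shift p u r v : F p u r v =
  (expR (- (u * v)) * p v) * (expR (u * (1 * r + v)) * expR (- expR (1 * r + v))).
Proof.
rewrite /F mul1r mulrDr (expRD (u * r)) (expRN (u * v)); field.
by rewrite gt_eqF// expR_gt0.
Qed.

Let integrable_F_r p u v : 0 < u -> mu.-integrable setT (EFin \o (F p u)^~ v).
Proof.
move=> u0; rewrite (funext (fun r => F_shift p u r v)).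
apply: integrable_scale.
apply: (@integrable_affine _ (fun x => expR (u * x) * expR (- expR x))) => //.
  by cont.
exact: integrable_gamma_kernel.
Qed.

Let integral_F_r p u v : 0 < u ->
  \int[mu]_r F p u r v = (expR (- (u * v)) * p v) * gammaR u.
Proof.
move=> u0; rewrite (funext (fun r => F_shift p u r v)).
have c : continuous (fun x => expR (u * x) * expR (- expR x)) by cont.
have i0 := integrable_gamma_kernel u0.
rewrite (RintegralZl _ measurableT (integrable_affine v ltr01 c i0)).
by rewrite (Rintegral_affine v ltr01 c i0) invr1 mul1r.
Qed.

Let cont_exp p : continuous p -> forall r, continuous (fun v => expR (- expR (r + v)) * p v).
Proof. by move=> cp r; cont. Qed.

Let integrable_laplace beta t p r : stable_log_density beta t p ->
  mu.-integrable setT (EFin \o (fun v => expR (- expR (r + v)) * p v)).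
Proof.
move=> [cp p0 hp]; apply: integrable_ge0.
- by apply: continuous_measurable_fun; exact: cont_exp.
- by move=> v; rewrite mulr_ge0 ?expR_ge0.
- by rewrite hp ltry.
Qed.

Let integrable_F_v beta t p u r : stable_log_density beta t p ->
  mu.-integrable setT (EFin \o F p u r).
Proof. by move=> hp; apply: integrable_scale; exact: integrable_laplace hp. Qed.

Let integral_F_v beta t p u r : stable_log_density beta t p ->
  \int[mu]_v F p u r v = expR (u * r) * expR (- (t * expR (beta * r))).
Proof.
move=> hp; rewrite RintegralZl//; last exact: integrable_laplace hp.
by rewrite /Rintegral; case: hp => _ _ ->.
Qed.

(** The Laplace transform exp(-t s^beta) is itself a Gamma kernel: t s^beta = exp(beta r + ln t), so
    an affine change of variable leads to Gamma(w/beta). *)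
Let shift_kernel beta t w r : 0 < beta -> 0 < t ->
  cexp (w * r%:C) * (expR (- (t * expR (beta * r))))%:C =
  cexp (- (w * (beta^-1)%:C * (ln t)%:C)) *
    gamma_kernel (w * (beta^-1)%:C) (beta * r + ln t).
Proof.
move=> b0 t0; rewrite /gamma_kernel mulrA -cexpD; congr (cexp _ * _).
  rewrite rmorphD rmorphM mulrDr addrCA addNr addr0 -mulrA; congr (_ * _).
  by rewrite mulrA -rmorphM mulVf ?gt_eqF// mul1r.
by rewrite expRD lnK ?posrE// mulrC.
Qed.

Let integrable_stretched beta t u : 0 < beta -> 0 < t -> 0 < u ->
  mu.-integrable setT (EFin \o (fun r => expR (u * r) * expR (- (t * expR (beta * r))))).
Proof.
move=> b0 t0 u0; have ub0 : 0 < u * beta^-1 by rewrite divr_gt0.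
have c : continuous (fun x => expR (u * beta^-1 * x) * expR (- expR x)) by cont.
have := integrable_scale (expR (- (u * beta^-1 * ln t)))
  (integrable_affine (ln t) b0 c (integrable_gamma_kernel ub0)).
apply: eq_integrable => // r _; congr EFin => /=.
rewrite mulrA -expRD [expR (_ + ln t)]expRD lnK ?posrE// [t * _]mulrC.
by congr (expR _ * _); field; rewrite gt_eqF.
Qed.

Let finite_F beta t p u : 0 < beta -> 0 < t -> 0 < u -> stable_log_density beta t p ->
  (\int[mu]_r \int[mu]_v (F p u r v)%:E < +oo)%E.
Proof.
move=> b0 t0 u0 hp.
have E r : (\int[mu]_v (F p u r v)%:E = (expR (u * r) * expR (- (t * expR (beta * r))))%:E)%E.
  rewrite -(integral_F_v u r hp) /Rintegral fineK//.
  exact: integrable_fin_num (integrable_F_v u r hp).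
under eq_integral do rewrite E.
have /integrableP[_] := integrable_stretched b0 t0 u0.
apply: le_lt_trans; rewrite le_eqVlt; apply/orP; left; apply/eqP.
by apply: eq_integral => r _; rewrite /= ger0_norm ?mulr_ge0 ?expR_ge0.
Qed.

(** Finiteness of the negative moment E X^(-u). By Tonelli, Gamma(u) times this moment is the double
    integral of [F], which is finite when v is integrated first. *)
Lemma integrable_mellin_kernel beta t p u :
  0 < beta -> 0 < t -> 0 < u -> stable_log_density beta t p ->
  mu.-integrable setT (EFin \o (fun v => expR (- (u * v)) * p v)).
Proof.
move=> b0 t0 u0 hp; have [cp p0 _] := hp.
have g0 := gammaR_gt0 u0.
have : mu.-integrable setT (EFin \o (fun v => gammaR u * (expR (- (u * v)) * p v))).
  apply: integrable_ge0.
  - by apply: continuous_measurable_fun; cont.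
  - by move=> v; rewrite mulr_ge0 ?mulr_ge0 ?expR_ge0// ltW.
  - have -> : (\int[mu]_v (gammaR u * (expR (- (u * v)) * p v))%:E =
        \int[mu]_v \int[mu]_r (F p u r v)%:E)%E.
      apply: eq_integral => v _; rewrite mulrC -integral_F_r// /Rintegral fineK//.
      exact: integrable_fin_num (integrable_F_r p v u0).
    have mF : measurable_fun setT (fun z : R * R => (F p u z.1 z.2)%:E).
      by apply/measurable_EFinP; exact: measurable_F.
    have F0 (z : R * R) : (0 <= (F p u z.1 z.2)%:E)%E.
      by rewrite lee_fin mulr_ge0 ?mulr_ge0 ?expR_ge0.
    have <- := @fubini_tonelli _ _ _ _ _ mu mu _ mF F0.
    exact: finite_F b0 t0 u0 hp.
move/(integrable_scale (gammaR u)^-1); apply: eq_integrable => // v _ /=.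
by rewrite mulrA mulVf ?mul1r// gt_eqF.
Qed.

Lemma cintegrable_mellin_kernel beta t p w : 0 < beta -> 0 < t ->
  0 < complex.Re w -> stable_log_density beta t p ->
  cintegrable (fun v => cexp (- (w * v%:C)) * (p v)%:C).
Proof.
move=> b0 t0 w0 hp; have [cp p0 _] := hp.
apply: (cintegrable_dominated _ _ _ (integrable_mellin_kernel b0 t0 w0 hp)).
- apply: continuous_measurable_fun.
  have -> : (fun v => complex.Re (cexp (- (w * v%:C)) * (p v)%:C)) =
     (fun v => expR (- (complex.Re w * v)) * cos (- (complex.Im w * v)) * p v).
    by apply/funext => v; rewrite Re_mulr Re_cexp Re_opp Im_opp Re_mulr Im_mulr.
  by cont.
- apply: continuous_measurable_fun.
  have -> : (fun v => complex.Im (cexp (- (w * v%:C)) * (p v)%:C)) =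
     (fun v => expR (- (complex.Re w * v)) * sin (- (complex.Im w * v)) * p v).
    by apply/funext => v; rewrite Im_mulr Im_cexp Re_opp Im_opp Re_mulr Im_mulr.
  by cont.
- move=> v; rewrite Normc.normcM normc_cexp normc_real Re_opp Re_mulr.
  by rewrite ger0_norm.
Qed.

Lemma mellin_gamma beta t p w : 0 < beta -> 0 < t -> 0 < complex.Re w ->
  stable_log_density beta t p ->
  cint (gamma_kernel w) * mellin p w =
  (beta^-1)%:C * cexp (- (w * (beta^-1)%:C * (ln t)%:C)) *
    cint (gamma_kernel (w * (beta^-1)%:C)).
Proof.
move=> b0 t0 w0 hp; have [cp p0 hpl] := hp.
set u := complex.Re w.
pose H r v : R[i] := cexp (w * r%:C) * (expR (- expR (r + v)) * p v)%:C.
have HF r v : Normc.normc (H r v) <= F p u r v.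
  rewrite Normc.normcM normc_cexp normc_real Re_mulr ger0_norm//.
  by rewrite mulr_ge0 ?expR_ge0.
have mk (k : R -> R) : continuous k -> measurable_fun setT (fun z : R * R =>
    expR (u * z.1) * k z.1 * (expR (- expR (z.1 + z.2)) * p z.2)).
  move=> ck.
  have -> : (fun z : R * R => expR (u * z.1) * k z.1 * (expR (- expR (z.1 + z.2)) * p z.2)) =
      (fun z => k z.1 * F p u z.1 z.2).
    by apply/funext => z; rewrite /F; ring.
  by apply: measurable_funM; [exact: measurable_1|exact: measurable_F].
have wb0 : 0 < complex.Re (w * (beta^-1)%:C) by rewrite Re_mulr divr_gt0.
have swap : cint (fun r => cint (H r)) = cint (fun v => cint (H^~ v)).
  apply: (@cint_swap _ H (F p u)) => //.
  - have -> : (fun z : R * R => complex.Re (H z.1 z.2)) = (fun z => expR (u * z.1) *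
        cos (complex.Im w * z.1) * (expR (- expR (z.1 + z.2)) * p z.2)).
      by apply/funext => z; rewrite Re_mulr Re_cexp Re_mulr Im_mulr.
    by apply: (mk (fun x => cos (complex.Im w * x))); cont.
  - have -> : (fun z : R * R => complex.Im (H z.1 z.2)) = (fun z => expR (u * z.1) *
        sin (complex.Im w * z.1) * (expR (- expR (z.1 + z.2)) * p z.2)).
      by apply/funext => z; rewrite Im_mulr Im_cexp Re_mulr Im_mulr.
    by apply: (mk (fun x => sin (complex.Im w * x))); cont.
  - exact: measurable_F.
  - by move=> r; exact: integrable_F_v hp.
  - by move=> v; exact: integrable_F_r.
  - exact: finite_F b0 t0 w0 hp.
have ig := cintegrable_gamma_kernel w0.
have igb := cintegrable_gamma_kernel wb0.
have cgr := @continuous_Re_gamma_kernel R.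
have cgi := @continuous_Im_gamma_kernel R.
have L : cint (fun r => cint (H r)) = (beta^-1)%:C *
    cexp (- (w * (beta^-1)%:C * (ln t)%:C)) * cint (gamma_kernel (w * (beta^-1)%:C)).
  transitivity (cint (fun r => cexp (- (w * (beta^-1)%:C * (ln t)%:C)) *
      gamma_kernel (w * (beta^-1)%:C) (beta * r + ln t))).
    have iL r := cintegrable_real (integrable_laplace r hp).
    apply: eq_cint => r; rewrite -(shift_kernel w r b0 t0).
    apply: etrans (cint_scale (cexp (w * r%:C)) (iL r)) _.
    by rewrite cint_real /Rintegral hpl.
  rewrite (cint_scale _ (cintegrable_affine (ln t) b0 (cgr _) (cgi _) igb)).
  by rewrite (cint_affine (ln t) b0 (cgr _) (cgi _) igb) mulrCA mulrA.
rewrite -L swap /mellin -(cint_scale _ (cintegrable_mellin_kernel b0 t0 w0 hp)).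
apply: eq_cint => v.
have -> : H^~ v = fun r => (cexp (- (w * v%:C)) * (p v)%:C) * gamma_kernel w (1 * r + v).
  apply/funext => r; rewrite /H /gamma_kernel mul1r rmorphM rmorphD mulrDr cexpD.
  have : cexp (- (w * v%:C)) * cexp (w * v%:C) = 1.
    by rewrite -cexpD addNr -[0]/(0%:C) cexp_real expR0.
  move: (cexp (- _)) (cexp (w * v%:C)) (cexp (w * r%:C)) => a b c ab.
  rewrite [in RHS](_ : _ * _ * _ = (a * b) * (c * ((expR (- expR (r + v)))%:C * (p v)%:C))).
    by rewrite ab mul1r.
  by ring.
rewrite (cint_scale _ (cintegrable_affine v ltr01 (cgr _) (cgi _) ig)).
by rewrite (cint_affine v ltr01 (cgr _) (cgi _) ig) invr1 mul1r mulrC.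
Qed.

End mellin_transform.

(** * Exponential decay on vertical lines *)

Section decay.
Context {R : realType}.
Implicit Types (beta t u y : R) (p : R -> R) (w : R[i]).

Lemma prod_le_exprn (q : nat -> R) (rho : R) (a b N : nat) : 0 <= rho <= 1 ->
  (forall k, 0 <= q k <= 1) -> (forall k, (a <= k < b)%N -> q k <= rho) ->
  (b <= N)%N -> \prod_(k < N) q k <= rho ^+ (b - a).
Proof.
move=> /andP[r0 r1] q01 qr bN.
have q0 k : 0 <= q k by have /andP[] := q01 k.
(* The exponent counts the indices of [a, b) among the first n. The minimum and the truncated
   subtraction cover n < a and n > b. *)
suff H n : \prod_(k < n) q k <= rho ^+ (minn n b - a).
  by have := H N; rewrite (minn_idPr bN).
elim: n => [|n IH]; first by rewrite big_ord0 min0n sub0n expr0.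
rewrite big_ord_recr /=; have p0 : 0 <= \prod_(k < n) q k by exact: prodr_ge0.
have [/andP[an nb]|h] := boolP (a <= n < b)%N.
  have -> : (minn n.+1 b - a = (minn n b - a).+1)%N.
    by rewrite (minn_idPl nb) (minn_idPl (ltnW nb)) subSn.
  by rewrite exprSr ler_pM// qr// an.
have -> : (minn n.+1 b - a = minn n b - a)%N by lia.
by rewrite (le_trans _ IH)// ler_piMr//; have /andP[] := q01 n.
Qed.

(* [|w + k| (u/beta + k) / (|w/beta + k| (u + k))] for w = u + i y and B = 1/beta *)
Let ratio (B u y : R) (k : nat) : R :=
  Normc.normc ((u + k%:R) +i* y) * (u * B + k%:R) /
  (Normc.normc ((u * B + k%:R) +i* (y * B)) * (u + k%:R)).

Let ratio_ge0 B u y k : 0 < B -> 0 < u -> 0 <= ratio B u y k.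
Proof.
move=> B0 u0.
have h1 : 0 <= u + k%:R by rewrite addr_ge0// ltW.
have h2 : 0 <= u * B + k%:R by rewrite addr_ge0// mulr_ge0// ltW.
by rewrite divr_ge0 ?mulr_ge0 ?normc_ge0.
Qed.

Let ratio_le B u y k (rho : R) : 0 < B -> 0 < u -> 0 <= rho ->
  ((u + k%:R) ^+ 2 + y ^+ 2) * (u * B + k%:R) ^+ 2 <=
    rho ^+ 2 * (((u * B + k%:R) ^+ 2 + (y * B) ^+ 2) * (u + k%:R) ^+ 2) ->
  ratio B u y k <= rho.
Proof.
move=> B0 u0 r0 h.
have a0 : 0 < u + k%:R by rewrite ltr_wpDr.
have b0 : 0 < u * B + k%:R by rewrite ltr_wpDr// mulr_gt0.
have n0 : 0 < Normc.normc ((u * B + k%:R) +i* (y * B)).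
  by rewrite /= sqrtr_gt0 ltr_wpDr ?sqr_ge0// exprn_gt0.
have h1 := mulr_gt0 n0 a0.
rewrite ler_pdivrMr//.
rewrite -ler_sqr ?nnegrE ?(mulr_ge0 (normc_ge0 _) (ltW b0)) ?(mulr_ge0 r0 (ltW h1))//.
by rewrite !exprMn !normc_sqr.
Qed.

(** In squares this compares 1 + (y / (u + k))^2 with 1 + (y B / (u B + k))^2, and u B + k <= B (u +
    k) because B > 1. *)
Let ratio_le1 B u y k : 1 < B -> 0 < u -> ratio B u y k <= 1.
Proof.
move=> B1 u0; have B0 : 0 < B by rewrite (lt_trans _ B1).
apply: ratio_le => //; rewrite expr1n mul1r.
have k0 : 0 <= k%:R :> R by [].
move: (k%:R) k0 => x x0.
have bB : u * B + x <= B * (u + x).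
  by rewrite mulrDr [u * B]mulrC lerD2l ler_peMl// ltW.
have b0 : 0 <= u * B + x by rewrite addr_ge0 ?mulr_ge0 ?(ltW u0) ?(ltW B0).
have h : (u * B + x) ^+ 2 <= (B * (u + x)) ^+ 2.
  by rewrite lerXn2r ?nnegrE// (le_trans b0).
have := ler_wpM2l (sqr_ge0 y) h.
have -> : ((u * B + x) ^+ 2 + (y * B) ^+ 2) * (u + x) ^+ 2 =
  (u + x) ^+ 2 * (u * B + x) ^+ 2 + y ^+ 2 * (B * (u + x)) ^+ 2 by ring.
by rewrite mulrDl lerD2l.
Qed.

(** With a = u + k and b = u B + k, the bounds u <= k <= |y| give a <= 2 k and a^2 <= 4 y^2. The
    first bounds the gain y^2 (B^2 a^2 - b^2) below with a loss of 2, the second bounds b^2 + y^2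
    B^2 by 5 B^2 y^2; together they make the 10. *)
Let ratio_le_rho B u y k : 1 < B -> 0 < u -> u <= k%:R -> k%:R <= `|y| ->
  ratio B u y k <= Num.sqrt (1 - (B - 1) / (10 * B)).
Proof.
move=> B1 u0 uk ky; have B0 : 0 < B by rewrite (lt_trans _ B1).
apply: ratio_le => //; rewrite sqr_sqrtr; last first.
  by rewrite subr_ge0 ler_pdivrMr ?mulr_gt0//; lra.
have k0 : 0 < k%:R :> R by rewrite (lt_le_trans u0).
move: (k%:R) uk ky k0 => x uk ky k0.
set a := u + x; set b := u * B + x.
have a0 : 0 < a by rewrite addr_gt0.
have bBa : b <= B * a.
  by rewrite /a /b mulrDr [u * B]mulrC lerD2l ler_peMl ?(ltW k0) ?(ltW B1).
have b0 : 0 < b by rewrite addr_gt0// mulr_gt0.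
have a2 : a <= 2 * x by rewrite /a; lra.
have ay : a ^+ 2 <= 4 * y ^+ 2.
  rewrite -(real_normK (num_real y)) (_ : 4 * _ = (2 * `|y|) ^+ 2); last by ring.
  have : a <= 2 * `|y| by lra.
  by move=> h; rewrite lerXn2r ?nnegrE ?(ltW a0)// (le_trans (ltW a0) h).
have y2 : 0 <= y ^+ 2 by exact: sqr_ge0.
have h2 : x * (B - 1) * (B * a) <= B ^+ 2 * a ^+ 2 - b ^+ 2.
  have -> : B ^+ 2 * a ^+ 2 - b ^+ 2 = (x * (B - 1)) * (B * a + b) by rewrite /a /b; ring.
  have h : 0 <= x * (B - 1) by rewrite mulr_ge0 ?subr_ge0 ?(ltW B1) ?(ltW k0).
  by rewrite (ler_wpM2l h)// lerDl ltW.
have h1 : b ^+ 2 <= B ^+ 2 * a ^+ 2.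
  rewrite -exprMn lerXn2r ?nnegrE ?(ltW b0)//.
  by rewrite (le_trans (ltW b0)).
have h3 : (b ^+ 2 + (y * B) ^+ 2) * a ^+ 2 <= 5 * B ^+ 2 * y ^+ 2 * a ^+ 2.
  rewrite ler_wpM2r ?sqr_ge0// exprMn.
  have := ler_wpM2l (sqr_ge0 B) ay; lra.
have e0 : 0 < (B - 1) / (10 * B) by rewrite divr_gt0 ?mulr_gt0 ?subr_gt0.
have h4 : (B - 1) / (10 * B) * (5 * B ^+ 2 * y ^+ 2 * a ^+ 2) <=
    y ^+ 2 * (x * (B - 1) * (B * a)).
  have -> : (B - 1) / (10 * B) * (5 * B ^+ 2 * y ^+ 2 * a ^+ 2) =
      (y ^+ 2 * ((B - 1) * (B * a))) * (a / 2) by field; rewrite gt_eqF.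
  have -> : y ^+ 2 * (x * (B - 1) * (B * a)) = (y ^+ 2 * ((B - 1) * (B * a))) * x by ring.
  have h : 0 <= y ^+ 2 * ((B - 1) * (B * a)).
    apply: (mulr_ge0 y2); rewrite mulr_ge0 ?subr_ge0 ?(ltW B1)//.
    exact: ltW (mulr_gt0 B0 a0).
  by rewrite ler_wpM2l//; lra.
have h5 := ler_wpM2l y2 h2.
have h6 := ler_wpM2l (ltW e0) h3.
have E : (b ^+ 2 + (y * B) ^+ 2) * a ^+ 2 =
  (a ^+ 2 + y ^+ 2) * b ^+ 2 + y ^+ 2 * (B ^+ 2 * a ^+ 2 - b ^+ 2) by ring.
rewrite [leRHS]mulrBl mul1r {1}E -addrA lerDl subr_ge0.
exact: le_trans h6 (le_trans h4 h5).
Qed.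

Let addC_nat u y (k : nat) : (u +i* y) + k%:R = (u + k%:R) +i* y.
Proof.
by apply: complex_ext; rewrite -(rmorph_nat (real_complex R)) ?Re_add ?Im_add /= ?addr0.
Qed.

Lemma normc_prod (z : nat -> R[i]) n :
  Normc.normc (\prod_(k < n) z k) = \prod_(k < n) Normc.normc (z k).
Proof.
elim: n => [|n IH]; first by rewrite !big_ord0 Normc.normc1.
by rewrite !big_ord_recr /= Normc.normcM IH.
Qed.

Lemma gammaR_shiftn v n : 0 < v ->
  gammaR (v + n%:R) = (\prod_(k < n) (v + k%:R)) * gammaR v :> R.
Proof.
move=> v0; elim: n => [|n IH]; first by rewrite big_ord0 addr0 mul1r.
have vn : 0 < v + n%:R by rewrite ltr_wpDr.
by rewrite -natr1 addrA (gammaRS vn) IH big_ord_recr /= mulrCA mulrA.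
Qed.

(** The subtraction is truncated: if b < a the left side is 1, and the right side is at least 1
    since x <= b < a. *)
Lemma exprn_le_expR (c x : R) (a b : nat) : 0 < c -> x <= b%:R ->
  expR (- c) ^+ (b - a) <= expR (c * a%:R) * expR (- (c * x)).
Proof.
move=> c0 xb; rewrite -expRM_natr -expRD ler_expR mulNr.
have h1 : b%:R <= (b - a)%:R + a%:R :> R.
  by rewrite -natrD ler_nat addnC -maxnE leq_maxr.
have : c * (x - a%:R) <= c * (b - a)%:R by rewrite ler_pM2l//; lra.
lra.
Qed.

Lemma exists_nat_bounds (x : R) (b : nat) :
  exists N : nat, [/\ x <= N%:R - 1, 2 <= N%:R :> R & (b <= N)%N].
Proof.
have [m hm] : exists m : nat, x <= m%:R.
  by exists (Num.truncn x).+1; rewrite ltW// truncnS_gt.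
have m0 : 0 <= m%:R :> R by [].
have b0' : 0 <= b%:R :> R by [].
by exists (2 + m + b)%N; split; [rewrite !natrD; lra|rewrite !natrD; lra|exact: leq_addl].
Qed.

(** Stated for abstract reals so that [field] sees atoms instead of products and Gamma values. *)
Let shift_identity (B T g' q g P Q p : R) : 0 < g -> 0 < P -> 0 < Q -> 0 < p ->
  B * T * (q * g' / Q) = p * g / 2 / P * (2 * (B * T * g' / g) * (P * q / (Q * p))).
Proof. by move=> g0 P0 Q0 p0; field; rewrite !gt_eqF. Qed.

(* Shifting both Gamma functions by N turns the quotient into a product of
   ratios, up to |Gamma(w/beta + N) / Gamma(w + N)|, which for N > y^2 is at most
   twice its value at y = 0. *)
Lemma mellin_decay beta t p u : 0 < beta < 1 -> 0 < t -> 0 < u ->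
  stable_log_density beta t p ->
  exists C c : R, 0 < c /\
    forall y, Normc.normc (mellin p (u +i* y)) <= C * expR (- (c * `|y|)).
Proof.
move=> /andP[b0 b1] t0 u0 hp; set B := beta^-1.
have B1 : 1 < B by rewrite invf_gt1.
have B0 : 0 < B by rewrite (lt_trans _ B1).
have uB0 : 0 < u * B by rewrite mulr_gt0.
set rho := Num.sqrt (1 - (B - 1) / (10 * B)).
have e0 : 0 < (B - 1) / (10 * B) by rewrite divr_gt0 ?mulr_gt0 ?subr_gt0.
have e1 : (B - 1) / (10 * B) < 1 by rewrite ltr_pdivrMr ?mulr_gt0//; lra.
have rho0 : 0 < rho by rewrite sqrtr_gt0 subr_gt0.
have rho1 : rho < 1.
  by rewrite -sqrtr1 ltr_sqrt// gtrDl oppr_lt0.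
pose c := - ln rho.
have c0 : 0 < c by rewrite oppr_gt0 ln_lt0// rho0.
have rhoE : rho = expR (- c) by rewrite opprK lnK ?posrE.
have [a ua] : exists a : nat, u <= a%:R.
  by exists (Num.truncn u).+1; rewrite ltW// truncnS_gt.
pose T := expR (- (u * B * ln t)).
have T0 : 0 < T by exact: expR_gt0.
have gu := gammaR_gt0 u0; have guB := gammaR_gt0 uB0.
(* [C0] is the value of the Mellin transform at y = 0, that is E X^(-u). It is kept opaque. *)
have [C0 C0E] : exists C0, C0 = B * T * gammaR (u * B) / gammaR u by eexists.
have C00 : 0 < C0 by rewrite C0E; exact: divr_gt0 (mulr_gt0 (mulr_gt0 B0 T0) guB) gu.
(* The 2 is lost in the lower bound on |Gamma(w + N)|, and exp(c a) compensates for the factors of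
   index k < a, which need not be below [rho]. *)
exists (2 * C0 * expR (c * a%:R)), c; split=> // y.
(* [b] is floor(|y|) + 1, so that k < b means k <= |y|. *)
have [b yb by_] : exists2 b : nat, `|y| <= b%:R & forall k, (k < b)%N -> k%:R <= `|y|.
  exists (Num.truncn `|y|).+1; first by rewrite ltW// truncnS_gt.
  move=> k kb; have /andP[h _] := truncn_itv (normr_ge0 y); apply: le_trans h.
  by rewrite ler_nat -ltnS.
(* N has to be large enough for the lower bound at w + N and to include all the indices in [a, b),
   whose factors are at most [rho]. *)
have [N [Ny N2 bN]] := exists_nat_bounds (y ^+ 2) b.
set w : R[i] := u +i* y.
have wBE : w * B%:C = (u * B) +i* (y * B).
  by apply: complex_ext; rewrite ?Re_mulr ?Im_mulr.
have rw0 : 0 < complex.Re w by [].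
have rwB0 : 0 < complex.Re (w * B%:C) by rewrite wBE.
have wN k : w + k%:R = (u + k%:R) +i* y by exact: addC_nat.
have wBN k : w * B%:C + k%:R = (u * B + k%:R) +i* (y * B) by rewrite wBE addC_nat.
pose PN := \prod_(k < N) Normc.normc ((u + k%:R) +i* y).
pose QN := \prod_(k < N) Normc.normc ((u * B + k%:R) +i* (y * B)).
pose pN := \prod_(k < N) (u + k%:R).
pose qN := \prod_(k < N) (u * B + k%:R).
pose Gw := Normc.normc (cint (gamma_kernel w)).
pose GwB := Normc.normc (cint (gamma_kernel (w * B%:C))).
have G1 : Normc.normc (cint (gamma_kernel (w + N%:R))) = PN * Gw.
  rewrite (gamma_shiftn _ rw0) Normc.normcM (normc_prod (fun k => w + k%:R)).
  by congr (_ * _); apply: eq_bigr => k _; rewrite wN.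
have G2 : Normc.normc (cint (gamma_kernel (w * B%:C + N%:R))) = QN * GwB.
  rewrite (gamma_shiftn _ rwB0) Normc.normcM (normc_prod (fun k => w * B%:C + k%:R)).
  by congr (_ * _); apply: eq_bigr => k _; rewrite wBN.
have G3 : pN * gammaR u / 2 <= PN * Gw.
  rewrite -G1 -(gammaR_shiftn N u0).
  have := @normc_gamma_ge R (w + N%:R); rewrite wN /=.
  by move: Ny N2; clear -u0 => Ny N2; apply; lra.
have G4 : QN * GwB <= qN * gammaR (u * B).
  rewrite -G2 -(gammaR_shiftn N uB0).
  have := @normc_gamma_le R (w * B%:C + N%:R); rewrite wBN /=; apply.
  by rewrite ltr_wpDr.
have M : Gw * Normc.normc (mellin p w) = B * T * GwB.
  rewrite -Normc.normcM (mellin_gamma b0 t0 rw0 hp) 2!Normc.normcM normc_real normc_cexp.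
  by rewrite (gtr0_norm B0) Re_opp !Re_mulr.
have PN0 : 0 < PN.
  apply: prodr_gt0 => k _; rewrite /= sqrtr_gt0 ltr_wpDr ?sqr_ge0// exprn_gt0//.
  by rewrite ltr_wpDr.
have QN0 : 0 < QN.
  apply: prodr_gt0 => k _; rewrite /= sqrtr_gt0 ltr_wpDr ?sqr_ge0// exprn_gt0//.
  by rewrite ltr_wpDr.
have pN0 : 0 < pN by apply: prodr_gt0 => k _; rewrite ltr_wpDr.
have qN0 : 0 < qN by apply: prodr_gt0 => k _; rewrite ltr_wpDr.
have rE : \prod_(k < N) ratio B u y k = PN * qN / (QN * pN).
  by rewrite /ratio big_split /= big_split /= prodfV big_split.
have rle : \prod_(k < N) ratio B u y k <= expR (c * a%:R) * expR (- (c * `|y|)).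
  apply: (@le_trans _ _ (rho ^+ (b - a))).
    apply: prod_le_exprn.
    - by rewrite !ltW.
    - by move=> k; rewrite ratio_ge0//= ratio_le1.
    - move=> k /andP[ak kb]; apply: ratio_le_rho => //.
        by rewrite (le_trans ua)// ler_nat.
      exact: by_.
    - exact: bN.
  by rewrite rhoE; exact: exprn_le_expR.
have gg0 : 0 < pN * gammaR u / 2 by exact: divr_gt0 (mulr_gt0 pN0 gu) _.
have gw0 : 0 < Gw.
  by rewrite -(pmulr_rgt0 _ PN0); exact: lt_le_trans gg0 G3.
have C200 : 0 <= 2 * C0 by rewrite mulr_ge0 ?(ltW C00).
have h := ler_wpM2l C200 rle; rewrite mulrA in h; apply: le_trans h.
(* After multiplication by |Gamma w|, the upper bound on |Gamma(w/beta + N)| and the lower bound on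
   |Gamma(w + N)| enter one after the other. *)
rewrite rE -(ler_pM2l gw0) M.
apply: (@le_trans _ _ (B * T * (qN * gammaR (u * B) / QN))).
  by rewrite (ler_wpM2l (ltW (mulr_gt0 B0 T0)))// ler_pdivlMr// mulrC.
apply: (@le_trans _ _ ((pN * gammaR u / 2 / PN) * (2 * C0 * (PN * qN / (QN * pN))))).
  by rewrite C0E (shift_identity B T _ _ gu PN0 QN0 pN0).
have r0 : 0 <= PN * qN / (QN * pN).
  exact: ltW (divr_gt0 (mulr_gt0 PN0 qN0) (mulr_gt0 QN0 pN0)).
apply: (ler_wpM2r (mulr_ge0 C200 r0)).
by rewrite (ler_pdivrMr _ _ PN0) [Gw * _]mulrC.
Qed.

End decay.

(** * Fourier inversion *)

Section abel_summation.
Context {R : realType}.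
Local Notation mu := (@lebesgue_measure R).
Implicit Types (a b c e y v : R) (G : R -> R).

Let continuous_abel e b : continuous (fun y => expR (- (e * `|y|)) * cos (b * y)).
Proof. by cont. Qed.

Let integrable_abel e b : 0 < e ->
  mu.-integrable setT (EFin \o (fun y => expR (- (e * `|y|)) * cos (b * y))).
Proof.
move=> e0; apply: (integrable_dominated _ _ (integrable_expR_norm e0)).
  by apply: continuous_measurable_fun; exact: continuous_abel.
by move=> y; rewrite normrM ger0_norm ?expR_ge0// ler_piMr ?expR_ge0// cos_max.
Qed.

Let sqr_sum_gt0 e b : 0 < e -> 0 < e ^+ 2 + b ^+ 2.
Proof. by move=> e0; rewrite ltr_pwDl ?exprn_gt0 ?sqr_ge0. Qed.

Lemma Rintegral_abel e b : 0 < e ->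
  \int[mu]_y (expR (- (e * `|y|)) * cos (b * y)) = 2 * e / (e ^+ 2 + b ^+ 2).
Proof.
move=> e0; have d0 := sqr_sum_gt0 b e0; have dn0 : e ^+ 2 + b ^+ 2 != 0 by rewrite gt_eqF.
(* The real part of a primitive of exp((-e + i b) y). Reflection gives a primitive on the negative
   half-line, and each half contributes - A 0 in the limit. *)
pose A y := (e ^+ 2 + b ^+ 2)^-1 * (expR (- e * y) * (b * sin (b * y) - e * cos (b * y))).
have dA (y : R) : is_derive y 1 A (expR (- e * y) * cos (b * y)).
  by derive => /=; field.
have dB (y : R) : is_derive y 1 (fun y => - A (- 1 * y)) (expR (e * y) * cos (b * y)).
  by derive => /=; rewrite !mulN1r !mulrN cosN mulNr opprK; field.
have iE := integrable_abel b e0.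
have E n : (0 < n)%N -> \int[mu]_(y in `[- n%:R, n%:R]) (expR (- (e * `|y|)) * cos (b * y)) =
    2 * (A n%:R - A 0).
  move=> n0; have n0' : 0 < n%:R :> R by rewrite ltr0n.
  have i1 : mu.-integrable `[- n%:R, n%:R]%classic
      (EFin \o (fun y => expR (- (e * `|y|)) * cos (b * y))).
    by apply: integrableS iE => //; exact: measurable_itv.
  have := Rintegral_itvB (a := BLeft (- n%:R)) (b := BRight n%:R) (x := 0) i1.
  rewrite !bnd_simp oppr_le0 => /(_ (ltW n0') (ltW n0')).
  rewrite Rintegral_itv_obnd_cbnd; last first.
    apply: integrableS iE => //; exact: measurable_itv.
  have -> : \int[mu]_(y in `[- n%:R, 0]) (expR (- (e * `|y|)) * cos (b * y)) = A n%:R - A 0.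
    rewrite (@eq_Rintegral _ _ _ mu _ (fun y => expR (e * y) * cos (b * y))).
      rewrite (Rintegral_derive _ _ dB) ?oppr_lt0//; last by cont.
      by rewrite mulr0 mulrNN mul1r; ring.
    by move=> y; rewrite inE /= in_itv /= => /andP[_ y0]; rewrite ler0_norm// mulrN opprK.
  have -> : \int[mu]_(y in `[0, n%:R]) (expR (- (e * `|y|)) * cos (b * y)) = A n%:R - A 0.
    rewrite (@eq_Rintegral _ _ _ mu _ (fun y => expR (- e * y) * cos (b * y))).
      by rewrite (Rintegral_derive _ _ dA)//; cont.
    by move=> y; rewrite inE /= in_itv /= => /andP[y0 _]; rewrite ger0_norm// mulNr.
  by move/eqP; rewrite subr_eq => /eqP ->; ring.
have cE : expR (- e * n%:R) @[n --> \oo] --> (0 : R).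
  apply: (@cvg_comp _ _ _ (fun n => n%:R) (fun x => expR (- e * x)) _ +oo_R).
    exact: cvgr_idn.
  under eq_fun do rewrite mulNr.
  apply: (@cvg_comp _ _ _ (fun x => e * x) (fun x => expR (- x)) _ +oo_R).
    exact: (gt0_cvgMry e0 cvg_id).
  exact: cvgr_expR.
have cA : A n%:R @[n --> \oo] --> (0 : R).
  pose k := (e ^+ 2 + b ^+ 2)^-1 * (`|b| + e).
  have c0 : k * expR (- e * n%:R) @[n --> \oo] --> (0 : R).
    by rewrite -[X in _ --> X](mulr0 k); apply: cvgM; [exact: cvg_cst|exact: cE].
  apply/norm_cvg0P; apply: squeeze_cvgr (cvg_cst 0) c0; apply: nearW => n.
  rewrite normr_ge0 /A normrM ger0_norm ?invr_ge0 ?(ltW d0)// /k -mulrA.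
  rewrite ler_wpM2l ?invr_ge0 ?(ltW d0)// normrM ger0_norm ?expR_ge0// mulrC.
  rewrite ler_wpM2r ?expR_ge0//; apply: le_trans (ler_normB _ _) _.
  by rewrite lerD// normrM ?(gtr0_norm e0) ler_piMr ?sin_max ?cos_max// ltW.
have A0 : A 0 = - (e / (e ^+ 2 + b ^+ 2)).
  by rewrite /A !mulr0 expR0 sin0 cos0; field.
have -> : 2 * e / (e ^+ 2 + b ^+ 2) = 2 * (0 - A 0) by rewrite A0; field.
apply: (cvg_unique _ (cvg_integral_centered iE)) => //.
have c2 : 2 * (A n%:R - A 0) @[n --> \oo] --> 2 * (0 - A 0).
  by apply: cvgM; [exact: cvg_cst|apply: cvgB; [exact: cA|exact: cvg_cst]].
apply: cvg_trans c2.
by apply: near_eq_cvg; near=> n => /=; rewrite E//; near: n; exact: nbhs_infty_gt.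
Unshelve. all: by end_near. Qed.

Let measurable_tensor (f g : R -> R) : measurable_fun setT f -> measurable_fun setT g ->
  measurable_fun setT (fun z : R * R => f z.1 * g z.2).
Proof.
move=> mf mg; apply: measurable_funM.
  exact: (measurableT_comp mf measurable_fst).
exact: (measurableT_comp mg measurable_snd).
Qed.

(** The factor exp(-e |y|) makes the double integral absolutely convergent, which allows the
    exchange; the inner integral in y is then explicit. *)
Lemma Rintegral_abel_fourier G a e : 0 < e -> continuous G ->
  mu.-integrable setT (EFin \o G) ->
  \int[mu]_y (expR (- (e * `|y|)) * \int[mu]_v (G v * cos (y * (v - a)))) =
  \int[mu]_v (G v * (2 * e / (e ^+ 2 + (v - a) ^+ 2))).
Proof.
move=> e0 cG iG.
have mG := continuous_measurable_fun cG.
have iN : mu.-integrable setT (EFin \o (fun v => `|G v|)) by exact: integrable_norm.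
pose k y v := expR (- (e * `|y|)) * (G v * cos (y * (v - a))).
pose F y v := expR (- (e * `|y|)) * `|G v|.
have cexpn : continuous (fun y => expR (- (e * `|y|))) by cont.
have iexp := integrable_expR_norm e0.
have kF y v : `|k y v| <= F y v.
  rewrite /k /F normrM ger0_norm ?expR_ge0// ler_wpM2l ?expR_ge0// normrM.
  by rewrite ler_piMr// cos_max.
have iFy y : mu.-integrable setT (EFin \o F y) by exact: integrable_scale.
have iFv v : mu.-integrable setT (EFin \o F^~ v).
  have := integrable_scale `|G v| iexp.
  by apply: eq_integrable => // y _ /=; rewrite /F mulrC.
have icos y : mu.-integrable setT (EFin \o (fun v => G v * cos (y * (v - a)))).
  apply: (integrable_dominated _ _ iN).
    by apply: continuous_measurable_fun; cont.
  by move=> v; rewrite normrM ler_piMr// cos_max.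
transitivity (\int[mu]_y \int[mu]_v k y v).
  by apply: eq_Rintegral => y _; rewrite (RintegralZl _ measurableT (icos y)).
rewrite (@Rintegral_swap_dominated _ k F)//.
- apply: eq_Rintegral => v _; rewrite -Rintegral_abel//.
  rewrite -(RintegralZl _ measurableT (integrable_abel (v - a) e0)).
  by apply: eq_Rintegral => y _; rewrite /k [y * _]mulrC; ring.
- apply: measurable_funM.
    exact: (measurableT_comp (continuous_measurable_fun cexpn) measurable_fst).
  apply: measurable_funM.
    exact: (measurableT_comp mG measurable_snd).
  apply: (measurableT_comp (continuous_measurable_fun (@continuous_cos R))).
  apply: measurable_funM; first exact: measurable_fst.
  by apply: measurable_funB; [exact: measurable_snd|exact: measurable_cst].
- have cN : continuous (fun v => `|G v|) by cont.
  exact: (measurable_tensor (continuous_measurable_fun cexpn) (continuous_measurable_fun cN)).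
- have E y : (\int[mu]_v (F y v)%:E = (expR (- (e * `|y|)) * \int[mu]_v `|G v|)%:E)%E.
    rewrite -(RintegralZl _ measurableT iN) /Rintegral fineK//.
    exact: integrable_fin_num (iFy y).
  under eq_integral do rewrite E.
  have := integrable_scale (\int[mu]_v `|G v|) iexp.
  move=> /(integrable_fin_num measurableT); rewrite ge0_fin_numE.
    by under eq_integral do rewrite /= mulrC.
  apply: integral_ge0 => y _; rewrite lee_fin mulr_ge0 ?expR_ge0//.
  exact: Rintegral_ge0.
Qed.

End abel_summation.

Section poisson_kernel.
Context {R : realType}.
Local Notation mu := (@lebesgue_measure R).
Implicit Types (a e v : R) (G : R -> R).

(** 2 pi times the Poisson kernel of the half-plane, so its total mass is 2 pi. *)
Let poisson e v : R := 2 * e / (e ^+ 2 + v ^+ 2).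

Let poissonE e v : 0 < e -> poisson e v = 2 / e * (1 + (v / e) ^+ 2)^-1.
Proof.
move=> e0; have : 0 < e ^+ 2 + v ^+ 2 by rewrite ltr_pwDl ?exprn_gt0 ?sqr_ge0.
rewrite /poisson => d0; field; rewrite !gt_eqF//.
Qed.

Let poisson_ge0 e v : 0 < e -> 0 <= poisson e v.
Proof. by move=> e0; rewrite divr_ge0 ?mulr_ge0 ?addr_ge0 ?sqr_ge0 ?ltW. Qed.

Let continuous_poisson a e : 0 < e -> continuous (fun v => poisson e (v - a)).
Proof.
move=> e0; rewrite (funext (fun v => poissonE (v - a) e0)).
apply: continuous_mul_fun; first by cont.
by apply: (continuous_comp_fun (@continuous_oneDsqrV_fun R)); cont.
Qed.

Let continuous_poisson_mul G a e : 0 < e -> continuous G ->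
  continuous (fun v => G v * poisson e (v - a)).
Proof.
by move=> e0 cG; apply: continuous_mul_fun => //; exact: continuous_poisson.
Qed.

Let integrable_poisson_mul G a e : 0 < e -> continuous G ->
  mu.-integrable setT (EFin \o G) ->
  mu.-integrable setT (EFin \o (fun v => G v * poisson e (v - a))).
Proof.
move=> e0 cG iG.
apply: (integrable_dominated _ _ (integrable_scale (2 / e) (integrable_norm iG))).
  by apply: continuous_measurable_fun; exact: continuous_poisson_mul.
move=> v; rewrite normrM (ger0_norm (poisson_ge0 _ e0)) [leRHS]mulrC ler_wpM2l//.
rewrite poissonE// ler_piMr ?divr_ge0 ?(ltW e0)//.
by rewrite invf_le1 ?oneDsqr_gt0// lerDl sqr_ge0.
Qed.

Let cvg_harmonic0 : (n.+1%:R^-1 : R) @[n --> \oo] --> (0 : R).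
Proof. exact: cvg_harmonic. Qed.

(** The substitution v = e r + a makes the kernel independent of e. Boundedness of G then provides
    the dominating function, and continuity at a the limit. *)
Let poisson_bounded G a (M : R) : continuous G -> (forall v, 0 <= G v <= M) ->
  mu.-integrable setT (EFin \o G) ->
  \int[mu]_v (G v * poisson n.+1%:R^-1 (v - a)) @[n --> \oo] --> 2 * pi * G a.
Proof.
move=> cG GM iG.
have E n : \int[mu]_v (G v * poisson n.+1%:R^-1 (v - a)) =
    \int[mu]_r (G (n.+1%:R^-1 * r + a) * (2 * (1 + r ^+ 2)^-1)).
  have e0 : 0 < n.+1%:R^-1 :> R by rewrite invr_gt0.
  move: (n.+1%:R^-1) e0 => e e0.
  have := Rintegral_affine a e0 (@continuous_poisson_mul G a e e0 cG)
    (integrable_poisson_mul a e0 cG iG).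
  move/(congr1 (fun z => e * z)); rewrite mulrA mulfV ?gt_eqF// mul1r => <-.
  rewrite -(RintegralZl e measurableT); last first.
    exact: (integrable_affine a e0 (@continuous_poisson_mul G a e e0 cG)
      (integrable_poisson_mul a e0 cG iG)).
  apply: eq_Rintegral => r _; rewrite addrK poissonE// [e * r]mulrC mulfK ?gt_eqF//.
  by rewrite mulrCA; congr (_ * _); rewrite !mulrA [e * 2]mulrC mulfK ?gt_eqF.
under eq_fun do rewrite E.
have iP : mu.-integrable setT (EFin \o (fun r : R => 2 * (1 + r ^+ 2)^-1)).
  exact: integrable_scale integrable_oneDsqrV.
have -> : 2 * pi * G a = \int[mu]_r (G a * (2 * (1 + r ^+ 2)^-1)).
  rewrite (RintegralZl _ measurableT iP) (RintegralZl _ measurableT integrable_oneDsqrV).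
  by rewrite /Rintegral integral_oneDsqrV /= mulrC.
have cP : continuous (fun r : R => 2 * (1 + r ^+ 2)^-1).
  by apply: continuous_mul_fun; [cont|exact: continuous_oneDsqrV_fun].
apply: (Rintegral_dominated_cvg _ _ _ (integrable_scale M iP)).
- move=> n; apply: continuous_measurable_fun; apply: continuous_mul_fun => //.
  by apply: (continuous_comp_fun cG); cont.
- by apply: continuous_measurable_fun; apply: continuous_mul_fun => //; cont.
- move=> r; apply: cvgM; last exact: cvg_cst.
  apply: (@cvg_comp _ _ _ (fun n => n.+1%:R^-1 * r + a) G _ (nbhs a)); last exact: cG.
  have -> : nbhs a = nbhs (0 * r + a) by rewrite mul0r add0r.
  by apply: cvgD; [apply: cvgM; [exact: cvg_harmonic0|exact: cvg_cst]|exact: cvg_cst].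
- move=> n r; have /andP[g0 gM] := GM (n.+1%:R^-1 * r + a).
  have p0 : 0 <= 2 * (1 + r ^+ 2)^-1 by rewrite mulr_ge0 ?invr_ge0 ?ltW ?oneDsqr_gt0.
  rewrite ger0_norm; last exact: mulr_ge0.
  exact: (ler_wpM2r p0 gM).
Qed.

(** At distance at least d from a the kernel is at most 2 e / d^2, so integrability of G is enough
    and no bound on G is required. *)
Let poisson_away G a (d : R) : 0 < d -> continuous G -> (forall v, 0 <= G v) ->
  (forall v, `|v - a| < d -> G v = 0) -> mu.-integrable setT (EFin \o G) ->
  \int[mu]_v (G v * poisson n.+1%:R^-1 (v - a)) @[n --> \oo] --> (0 : R).
Proof.
move=> d0 cG G0 Ga iG; pose k := 2 / d ^+ 2 * \int[mu]_v G v.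
have c0 : k * n.+1%:R^-1 @[n --> \oo] --> (0 : R).
  by rewrite -[X in _ --> X](mulr0 k); apply: cvgM; [exact: cvg_cst|exact: cvg_harmonic0].
apply: squeeze_cvgr (cvg_cst 0) c0; apply: nearW => n.
have e0 : 0 < n.+1%:R^-1 :> R by rewrite invr_gt0.
move: (n.+1%:R^-1) e0 => e e0.
rewrite Rintegral_ge0/=; last by move=> v _; rewrite mulr_ge0// poisson_ge0.
rewrite /k mulrAC -(RintegralZl _ measurableT iG); apply: le_Rintegral => //.
- exact: integrable_poisson_mul.
- exact: integrable_scale.
- move=> v _; have [/Ga ->|dv] := ltP `|v - a| d; first by rewrite mul0r mulr0.
  rewrite mulrC; apply: (ler_wpM2r (G0 v)); rewrite /poisson [leRHS]mulrAC.
  have e20 : 0 <= 2 * e by rewrite mulr_ge0 ?(ltW e0).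
  rewrite (ler_wpM2l e20)// lef_pV2 ?posrE ?exprn_gt0//; last first.
    by rewrite ltr_pwDl ?exprn_gt0 ?sqr_ge0.
  rewrite ler_wpDl ?sqr_ge0// -(real_normK (num_real (v - a))).
  by rewrite lerXn2r ?nnegrE ?(ltW d0).
Qed.

Lemma poisson_integral_cvg G a : continuous G -> (forall v, 0 <= G v) ->
  mu.-integrable setT (EFin \o G) ->
  \int[mu]_v (G v * (2 * n.+1%:R^-1 / (n.+1%:R^-1 ^+ 2 + (v - a) ^+ 2)))
    @[n --> \oo] --> 2 * pi * G a.
Proof.
(* G may be unbounded, so it is cut at a level strictly above G a. By continuity the cut is inactive
   near a, so the remainder [G2] vanishes there. The minimum is written with an absolute value to
   make its continuity syntactic. *)
move=> cG G0 iG; pose M := G a + 1.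
pose G1 v := (G v + M - `|G v - M|) / 2.
have G1E v : G1 v = Num.min (G v) M by rewrite minr_absE.
have M0 : 0 <= M by rewrite addr_ge0.
have c1 : continuous G1 by rewrite /G1; cont.
have G1M v : 0 <= G1 v <= M by rewrite G1E le_min G0 M0 ge_min lexx orbT.
have G1G v : G1 v <= G v by rewrite G1E ge_min lexx.
have i1 : mu.-integrable setT (EFin \o G1).
  apply: (integrable_dominated _ _ iG); first exact: continuous_measurable_fun.
  by move=> v; have /andP[h _] := G1M v; rewrite ger0_norm.
pose G2 v := G v - G1 v.
have c2 : continuous G2 by rewrite /G2; cont.
have i2 : mu.-integrable setT (EFin \o G2).
  have := integrable_add iG (integrable_scale (-1) i1).
  by apply: eq_integrable => // v _ /=; rewrite mulN1r.
have /cvgrPdist_lt/(_ 1 ltr01)/nbhs_ballP[d /= d0 hd] := cG a.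
have G20 v : `|v - a| < d -> G2 v = 0.
  move=> vd; have : `|G a - G v| < 1 by apply: hd; rewrite /ball /= distrC.
  rewrite distrC => /(le_lt_trans (ler_norm _)); rewrite ltrBlDr addrC -/M => h.
  by rewrite /G2 G1E (min_idPl (ltW h)) subrr.
have l1 := poisson_bounded (a := a) c1 G1M i1.
have G2_ge0 v : 0 <= G2 v by rewrite subr_ge0.
have l2 := poisson_away d0 c2 G2_ge0 G20 i2.
have -> : 2 * pi * G a = 2 * pi * G1 a + 0.
  by rewrite addr0 G1E (min_idPl _)// /M lerDl.
apply: cvg_trans (cvgD l1 l2); apply: near_eq_cvg; apply: nearW => n /=.
have e0 : 0 < n.+1%:R^-1 :> R by rewrite invr_gt0.
set e : R := n.+1%:R^-1 in e0 *.
have -> : \int[mu]_v (G v * (2 * e / (e ^+ 2 + (v - a) ^+ 2))) =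
    \int[mu]_v (G1 v * poisson e (v - a)) + \int[mu]_v (G2 v * poisson e (v - a)).
  apply: etrans (RintegralD measurableT (integrable_poisson_mul a e0 c1 i1)
    (integrable_poisson_mul a e0 c2 i2)).
  by apply: eq_Rintegral => v _; rewrite -mulrDl /G2 addrCA subrr addr0.
by [].
Qed.

End poisson_kernel.

Section inversion_formula.
Context {R : realType}.
Local Notation mu := (@lebesgue_measure R).
Implicit Types (a y v : R) (G : R -> R).

Lemma Rintegral_odd (S : R -> R) : continuous S -> mu.-integrable setT (EFin \o S) ->
  (forall y, S (- y) = - S y) -> \int[mu]_y S y = 0.
Proof.
move=> cS iS oS.
apply: (cvg_unique _ (cvg_integral_centered iS)) => //.
apply: cvg_near_cst; apply: nearW => n.
have in0 : mu.-integrable `[- n%:R, n%:R]%classic (EFin \o S).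
  by apply: integrableS iS => //; exact: measurable_itv.
have nn : - n%:R <= n%:R :> R by rewrite (@le_trans _ _ 0)// oppr_le0.
have := @integration_by_substitution_oppr R S (- n%:R) n%:R nn (continuous_subspaceT cS).
rewrite opprK => /(congr1 fine) h.
have : \int[mu]_(y in `[- n%:R, n%:R]) S y = - \int[mu]_(y in `[- n%:R, n%:R]) S y.
  rewrite -[RHS]mulN1r -(RintegralZl _ _ in0); last exact: measurable_itv.
  rewrite [LHS]h; congr fine; apply: eq_integral => y _.
  by rewrite /= oS mulN1r.
by move=> /eqP; rewrite -addr_eq0 -mulr2n mulrn_eq0 /= => /eqP.
Qed.

Let continuous_transform G (k : R -> R) a : (forall z, `|k z| <= 1) -> continuous k ->
  continuous G -> mu.-integrable setT (EFin \o G) ->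
  continuous (fun y => \int[mu]_v (G v * k (y * (v - a)))).
Proof.
move=> k1 ck cG iG y.
have bound z v : `|G v * k (z * (v - a))| <= `|G v|.
  by rewrite normrM ler_piMr.
have ckz z : continuous (fun v => k (z * (v - a))).
  by apply: (continuous_comp_fun ck); cont.
apply: (@continuity_under_integral R _ _ mu (fun z v => G v * k (z * (v - a))) setT
  measurableT (y - 1) (y + 1) _ _ (fun v => `|G v|)).
- move=> z _; apply: (integrable_dominated _ (bound z) (integrable_norm iG)).
  apply: continuous_measurable_fun.
  exact: (continuous_mul_fun cG (ckz z)).
- apply: aeW => v _ z _.
  have ckv : continuous (fun z : R => k (z * (v - a))).
    by apply: (continuous_comp_fun ck); cont.
  by apply: cvgM; [exact: cvg_cst|exact: ckv].
- exact: integrable_norm.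
- by move=> z _; apply: aeW => v _; exact: bound.
- by rewrite inE /= in_itv /=; lra.
Qed.

Lemma continuous_cos_transform G a : continuous G -> mu.-integrable setT (EFin \o G) ->
  continuous (fun y => \int[mu]_v (G v * cos (y * (v - a)))).
Proof.
by move=> cG iG; apply: continuous_transform => //;
  [exact: cos_max|exact: continuous_cos].
Qed.

Lemma continuous_sin_transform G a : continuous G -> mu.-integrable setT (EFin \o G) ->
  continuous (fun y => \int[mu]_v (G v * sin (y * (v - a)))).
Proof.
by move=> cG iG; apply: continuous_transform => //;
  [exact: sin_max|exact: continuous_sin].
Qed.

(** The identity between Abel means and Poisson integrals is taken to the limit e = 1/(n+1) -> 0.
    Integrability of the cosine transform dominates the Abel means, and the Poisson integrals tend
    to 2 pi G a. *)
Lemma fourier_inversion G a : continuous G -> (forall v, 0 <= G v) ->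
  mu.-integrable setT (EFin \o G) ->
  mu.-integrable setT (EFin \o (fun y => \int[mu]_v (G v * cos (y * (v - a))))) ->
  \int[mu]_y \int[mu]_v (G v * cos (y * (v - a))) = 2 * pi * G a.
Proof.
move=> cG G0 iG; set K := fun y => \int[mu]_v (G v * cos (y * (v - a))).
move=> iK; have cK : continuous K by exact: continuous_cos_transform.
have l1 := poisson_integral_cvg (a := a) cG G0 iG.
have E n : \int[mu]_v (G v * (2 * n.+1%:R^-1 / (n.+1%:R^-1 ^+ 2 + (v - a) ^+ 2))) =
    \int[mu]_y (expR (- (n.+1%:R^-1 * `|y|)) * K y).
  by rewrite -Rintegral_abel_fourier// invr_gt0.
rewrite (funext E) in l1.
apply: (cvg_unique _ _ l1) => //.
apply: (Rintegral_dominated_cvg _ _ _ (integrable_norm iK)).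
- by move=> n; apply: continuous_measurable_fun; cont.
- exact: continuous_measurable_fun.
- move=> y; rewrite -[X in _ --> X]mul1r; apply: cvgM; last exact: cvg_cst.
  have cz : - (n.+1%:R^-1 * `|y|) @[n --> \oo] --> - (0 * `|y|).
    by apply: cvgN; apply: cvgM; [exact: cvg_harmonic|exact: cvg_cst].
  rewrite mul0r oppr0 in cz; rewrite -[X in _ --> X]expR0.
  exact: (continuous_cvg _ (@continuous_expR R 0) cz).
- move=> n y; rewrite normrM ger0_norm ?expR_ge0// ler_piMl//.
Qed.

End inversion_formula.

(** * The logarithmic density *)

Section density_of_a_random_variable.
Context {R : realType} {d : measure_display} {T : measurableType d} {P : probability T R}.
Local Notation mu := (@lebesgue_measure R).

(** The hypothesis describes the law of X on sets only. Its Radon-Nikodym derivative has the same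
    integrals on all measurable sets as f extended by 0, hence agrees with it almost everywhere, and
    the change of measure follows. *)
Lemma expectation_density (X : {RV P >-> R}) (f g : R -> R) :
  is_continuous_density X f -> measurable_fun setT g -> (forall x, 0 <= g x) ->
  (\int[P]_w (g (X w))%:E = \int[mu]_(x in `]0%R, +oo[) (g x * f x)%:E)%E.
Proof.
case=> f0 cf hf mg g0.
pose D : set R := `]0, +oo[%classic.
have mD : measurable D by exact: measurable_itv.
pose fb : R -> \bar R := (EFin \o f) \_ D.
have mfD : measurable_fun D f.
  apply: open_continuous_measurable_fun; first exact: interval_open.
  by move=> x; rewrite inE /D /= in_itv /= andbT; exact: cf.
have mfb : measurable_fun setT fb.
  by apply/(measurable_restrictT _ mD); apply/measurable_EFinP.
have fb0 x : (0 <= fb x)%E.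
  by apply: erestrict_ge0 => {}x; rewrite /D /= in_itv /= andbT => x0; rewrite lee_fin f0.
have hfb A : measurable A -> (P (X @^-1` A) = \int[mu]_(x in A) fb x)%E.
  by move=> mA; rewrite hf// integral_mkcondr.
have ifb : mu.-integrable setT fb.
  apply/integrableP; split=> //.
  under eq_integral do rewrite gee0_abs//.
  by rewrite -hfb// preimage_setT probability_setT ltry.
(* X is given this codomain so that its law and Lebesgue measure live on the same measurable
   type. *)
pose X1 : T -> measurableTypeR R := X.
have mX1 : measurable_fun setT X1 by exact: (measurable_funPT X).
pose X' : {RV P >-> measurableTypeR R} := HB.pack X1 (isMeasurableFun.Build _ _ _ _ X1 mX1).
pose nu := [the {finite_measure set (measurableTypeR R) -> \bar R} of distribution P X'].
pose la := [the {sigma_finite_measure set (measurableTypeR R) -> \bar R} of mu].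
have nuE (A : set (measurableTypeR R)) : measurable A -> (nu A = \int[la]_(x in A) fb x)%E.
  exact: hfb.
have numu : nu `<< la.
  apply/null_content_dominatesP => A mA A0.
  by rewrite nuE//; apply: null_set_integral => //; exact: measurable_funTS.
have ae : ae_eq mu setT (Radon_Nikodym_SigmaFinite.f nu la) fb.
  apply: integral_ae_eq => //.
  - exact: Radon_Nikodym_SigmaFinite.f_integrable.
  - by move=> A _ mA; rewrite -nuE// -Radon_Nikodym_SigmaFinite.f_integral.
have mgE : measurable_fun setT (EFin \o g) by exact/measurable_EFinP.
transitivity (\int[nu]_x (g x)%:E)%E.
  by rewrite /nu ge0_integral_distribution// => x; rewrite lee_fin.
rewrite -(Radon_Nikodym_SigmaFinite.change_of_variables numu)//.
rewrite [RHS]integral_mkcond.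
have -> : ((fun x => (g x * f x)%:E) \_ `]0%R, +oo[) = (fun x => (g x)%:E * fb x)%E.
  apply/funext => x; rewrite /fb !patchE; case: ifPn => _; last by rewrite mule0.
  by rewrite EFinM.
apply: ae_eq_integral => //.
- apply: emeasurable_funM => //.
  by apply: (measurable_int mu); exact: Radon_Nikodym_SigmaFinite.f_integrable.
- exact: emeasurable_funM.
- exact: ae_eqe_mul2l.
Qed.

End density_of_a_random_variable.

Section log_density.
Context {R : realType} {d : measure_display} {T : measurableType d} {P : probability T R}.
Local Notation mu := (@lebesgue_measure R).

Lemma stable_subordinator_log_density (D : R -> {RV P >-> R}) (f : R -> R) (beta t : R) :
  0 < t -> stable_subordinator beta D -> is_continuous_density (D t) f ->
  stable_log_density beta t (fun v => f (expR v) * expR v).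
Proof.
move=> t0 [_ _ hE] hf; have [f0 cf _] := hf.
have cfi : {in `]0, +oo[, continuous f}.
  by move=> x; rewrite in_itv /= andbT; exact: cf.
split.
- move=> v; apply: cvgM; last exact: continuous_expR.
  apply: continuous_comp; first exact: continuous_expR.
  by apply: cf; exact: expR_gt0.
- by move=> v; rewrite mulr_ge0 ?expR_ge0// f0 ?expR_gt0.
move=> r.
have mg : measurable_fun setT (fun x : R => expR (- expR r * x)).
  by apply: continuous_measurable_fun; cont.
have := hE (expR r) t (expR_gt0 r) (ltW t0).
rewrite unlock (expectation_density hf mg); last by move=> x; exact: expR_ge0.
rewrite [expR r `^ beta](_ : _ = expR (beta * r)); last by rewrite mulrC expRM.
rewrite mulNr => <-.
rewrite integral_exp_subst.
  by apply: eq_integral => v _; rewrite mulrA mulNr -expRD.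
move=> x x0; apply: cvgM; last exact: cfi.
have cg : continuous (fun x => expR (- expR r * x)) by cont.
exact: cg.
Qed.

End log_density.

(** * Mellin inversion and the H-function *)

Section mellin_inversion.
Context {R : realType}.
Local Notation mu := (@lebesgue_measure R).
Implicit Types (beta t u a y : R) (p : R -> R).

(** The real part u of the exponent is absorbed into the density. The weight is 1 at v = a, so
    inversion at a returns p a for every u. *)
Definition weighted u a p v : R := expR (u * (a - v)) * p v.

Definition cos_part u a p y : R := \int[mu]_v (weighted u a p v * cos (y * (v - a))).
Definition sin_part u a p y : R := \int[mu]_v (weighted u a p v * sin (y * (v - a))).

Lemma weightedE u a p v : weighted u a p v = expR (u * a) * (expR (- (u * v)) * p v).
Proof. by rewrite /weighted mulrBr expRD mulrA. Qed.

(** The imaginary part is -y because w = 1 - s on the line s = c + i y. Multiplying by exp(w a)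
    centres the phase at a. *)
Lemma mellin_cos_sin beta t p u a y : 0 < beta -> 0 < t -> 0 < u ->
  stable_log_density beta t p ->
  mellin p (u +i* (- y)) * cexp ((u +i* (- y)) * a%:C) =
  cos_part u a p y +i* sin_part u a p y.
Proof.
move=> b0 t0 u0 hp; set w : R[i] := u +i* (- y).
have iM := cintegrable_mellin_kernel (w := w) b0 t0 u0 hp.
rewrite mulrC -(cint_scale _ iM).
have E v : cexp (w * a%:C) * (cexp (- (w * v%:C)) * (p v)%:C) =
    (weighted u a p v * cos (y * (v - a))) +i* (weighted u a p v * sin (y * (v - a))).
  rewrite mulrA -cexpD -mulrBr -rmorphB.
  have yE : - y * (a - v) = y * (v - a) by ring.
  apply: complex_ext.
    by rewrite Re_mulr Re_cexp Re_mulr Im_mulr [complex.Im w]/= yE mulrAC.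
  by rewrite Im_mulr Im_cexp Re_mulr Im_mulr [complex.Im w]/= yE mulrAC.
by rewrite (eq_cint E).
Qed.

(** Decay makes both parts integrable; the cosine part is inverted and the sine part is odd in y. *)
Lemma mellin_inversion beta t p u a : 0 < beta < 1 -> 0 < t -> 0 < u ->
  stable_log_density beta t p ->
  [/\ mu.-integrable setT (EFin \o cos_part u a p),
      mu.-integrable setT (EFin \o sin_part u a p),
      \int[mu]_y cos_part u a p y = 2 * pi * p a &
      \int[mu]_y sin_part u a p y = 0].
Proof.
move=> b01 t0 u0 hp; have /andP[b0 _] := b01; have [cp p0 _] := hp.
have [C [c [c0 hC]]] := mellin_decay b01 t0 u0 hp.
have cW : continuous (weighted u a p) by rewrite /weighted; cont.
have W0 v : 0 <= weighted u a p v by rewrite mulr_ge0 ?expR_ge0.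
have iW : mu.-integrable setT (EFin \o weighted u a p).
  have := integrable_scale (expR (u * a)) (integrable_mellin_kernel b0 t0 u0 hp).
  by apply: eq_integrable => // v _ /=; rewrite weightedE.
have bound y : Normc.normc (cos_part u a p y +i* sin_part u a p y) <=
    C * expR (u * a) * expR (- (c * `|y|)).
  rewrite -(mellin_cos_sin a y b0 t0 u0 hp) Normc.normcM normc_cexp Re_mulr /= [leRHS]mulrAC.
  by rewrite -(normrN y); apply: ler_wpM2r; [exact: expR_ge0|exact: hC].
have iD := integrable_scale (C * expR (u * a)) (integrable_expR_norm c0).
have cC : continuous (cos_part u a p) by exact: continuous_cos_transform.
have cS : continuous (sin_part u a p) by exact: continuous_sin_transform.
have iC : mu.-integrable setT (EFin \o cos_part u a p).
  apply: (integrable_dominated _ _ iD); first exact: continuous_measurable_fun.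
  by move=> y; apply: le_trans (bound y); exact: (Re_le_normc (_ +i* _)).
have iS : mu.-integrable setT (EFin \o sin_part u a p).
  apply: (integrable_dominated _ _ iD); first exact: continuous_measurable_fun.
  by move=> y; apply: le_trans (bound y); exact: (Im_le_normc (_ +i* _)).
split=> //.
- rewrite /cos_part (fourier_inversion cW W0 iW iC).
  by rewrite /weighted subrr mulr0 expR0 mul1r.
- apply: (Rintegral_odd cS iS) => y.
  have iSv : mu.-integrable setT (EFin \o (fun v => weighted u a p v * sin (y * (v - a)))).
    apply: (integrable_dominated _ _ iW).
      apply: continuous_measurable_fun.
      by apply: (continuous_mul_fun cW (g := fun v => sin (y * (v - a)))); cont.
    by move=> v; rewrite normrM (ger0_norm (W0 v)) ler_piMr// sin_max.
  rewrite /sin_part -[RHS]mulN1r -(RintegralZl (-1) measurableT iSv).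
  by apply: eq_Rintegral => v _; rewrite mulNr sinN mulrN mulN1r.
Qed.

End mellin_inversion.

Section fox_H_line.
Context {R : realType}.
Local Notation mu := (@lebesgue_measure R).
Implicit Types (beta t u a x y c : R) (p : R -> R).

Definition stable_upper beta : seq (R[i] * R) := [:: (1 - (beta^-1)%:C, beta^-1)].
Definition stable_lower : seq (R[i] * R) := [:: (0, 1)].

(** Since m = 0, no singularity has to lie to the left. Those of Gamma((1 - s)/beta) are s = 1 +
    beta j, and the leftmost is s = 1. *)
Lemma stable_separates beta c : 0 < beta ->
  foxH_separates 0 1 (stable_upper beta) stable_lower c <-> c < 1.
Proof.
move=> b0; have B0 : (beta^-1)%:C != 0 :> R[i] by rewrite fmorph_eq0 gt_eqF ?invr_gt0.
split=> [h|c1 s].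
- have [_ /(_ (1 - (beta^-1)%:C, beta^-1))] := h 1.
  apply; first by rewrite mem_seq1.
  by exists 0%N; rewrite /= mulr1 oppr0 opprB addrCA subrr addr0 subrr.
- split=> [l|k]; first by rewrite in_nil.
  rewrite /= mem_seq1 => /eqP -> /= [j hj].
  have : complex.Re (1 - (1 - (beta^-1)%:C) - (beta^-1)%:C * s) = - j%:R.
    by rewrite hj -(rmorph_nat (real_complex R)) Re_opp.
  rewrite opprB addrCA subrr addr0 Re_add Re_opp [_ * s]mulrC Re_mulr /= => h.
  have : (complex.Re s - 1) / beta = j%:R by lra.
  have : 0 <= j%:R :> R by [].
  move=> j0 h'; have : 0 <= (complex.Re s - 1) / beta by rewrite h'.
  by rewrite pmulr_lge0 ?invr_gt0// subr_ge0; exact: lt_le_trans.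
Qed.

(** With w = 1 - s, chi(s) is Gamma(w/beta)/Gamma(w) and z^(-s) = z^(w-1). The power t^(w/beta)
    cancels the one in the Mellin transform, leaving x^w and the constant beta / z. *)
Lemma stable_chi_line beta t p x c y : 0 < beta -> 0 < t -> 0 < x -> c < 1 ->
  stable_log_density beta t p ->
  let s := c +i* y in
  foxH_chi 0 1 (stable_upper beta) stable_lower s * cpow (x / t `^ beta^-1) (- s) =
  (beta * t `^ beta^-1 / x)%:C *
    (mellin p ((1 - c) +i* (- y)) * cexp (((1 - c) +i* (- y)) * (ln x)%:C)).
Proof.
move=> b0 t0 x0 c1 hp s; set w : R[i] := (1 - c) +i* (- y).
have sE : s = 1 - w.
  by apply: complex_ext => /=; ring.
have w0 : 0 < complex.Re w by rewrite /= subr_gt0.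
have wB0 : 0 < complex.Re (w * (beta^-1)%:C) by rewrite Re_mulr mulr_gt0 ?invr_gt0.
have -> : foxH_chi 0 1 (stable_upper beta) stable_lower s =
    cint (gamma_kernel (w * (beta^-1)%:C)) / cint (gamma_kernel w).
  rewrite /foxH_chi /= !big_cons !big_nil /= !mulr1 mul1r sE.
  rewrite -(Gamma_line wB0) -(Gamma_line w0); congr (Gamma _ / Gamma _); by ring.
have g0 := gamma_neq0 w0.
pose L := ln t / beta.
have hm := mellin_gamma b0 t0 w0 hp.
have hG : cint (gamma_kernel (w * (beta^-1)%:C)) / cint (gamma_kernel w) =
    beta%:C * cexp (w * L%:C) * mellin p w.
  have e0 : cexp (- (w * (beta^-1)%:C * (ln t)%:C)) * cexp (w * L%:C) = 1.
    rewrite -cexpD [X in cexp X](_ : _ = 0%:C) ?cexp_real ?expR0//.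
    by rewrite /L rmorphM; ring.
  have bb : beta%:C * (beta^-1)%:C = 1 by rewrite -rmorphM mulfV ?gt_eqF.
  apply: (mulIf g0); rewrite mulfVK// [RHS]mulrAC -mulrA hm.
  move: e0 bb; move: (cexp (- (w * (beta^-1)%:C * (ln t)%:C))) (cexp (w * L%:C))
    (cint (gamma_kernel (w * (beta^-1)%:C))) => e1 e2 g e12 bb.
  rewrite (_ : beta%:C * e2 * _ = (beta%:C * (beta^-1)%:C) * (e1 * e2) * g); last by ring.
  by rewrite bb e12 !mul1r.
rewrite hG /cpow ln_div ?posrE ?powR_gt0// ln_powR.
have -> : beta^-1 * ln t = L by rewrite mulrC.
have EL : cexp (w * L%:C) * cexp (- s * (ln x - L)%:C) =
    cexp (w * (ln x)%:C) * (t `^ beta^-1 / x)%:C.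
  have -> : t `^ beta^-1 / x = expR (L - ln x).
    by rewrite expRB lnK ?posrE// /powR (gt_eqF t0) /L [_ * ln t]mulrC.
  rewrite -cexp_real -!cexpD; congr cexp.
  by rewrite sE !rmorphB; ring.
rewrite (_ : _ * _ * _ * _ = beta%:C * mellin p w *
  (cexp (w * L%:C) * cexp (- s * (ln x - L)%:C))); last by ring.
by rewrite EL -[beta * _ / _]mulrA [(beta * _)%:C]rmorphM; ring.
Qed.

End fox_H_line.

Section improper_integrals.
Context {R : realType}.
Local Notation mu := (@lebesgue_measure R).
Implicit Types (g : R -> R[i]) (v h c z : R[i]).

Lemma is_improper_integral_unique g v v' :
  is_improper_integral g v -> is_improper_integral g v' -> v = v'.
Proof.
case=> _ cr ci [_ cr' ci']; apply: complex_ext.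
- exact: (cvg_unique _ cr cr').
- exact: (cvg_unique _ ci ci').
Qed.

Lemma is_improper_integral_cint g : cintegrable g -> is_improper_integral g (cint g).
Proof.
move=> [ir ii]; split=> [a b||].
- by split; [apply: integrableS ir|apply: integrableS ii] => //; exact: measurable_itv.
- exact: cvg_improper_integral.
- exact: cvg_improper_integral.
Qed.

(** Two candidate values can be compared on a common separating line, where the improper integral is
    unique; this forces the choice of [xget]. *)
Lemma foxHE m n up lo (z : R) h : is_foxH m n up lo z h -> foxH m n up lo z = h.
Proof.
move=> hh; rewrite /foxH; apply: xget_unique => // h'.
case: hh => _ [c sc] /(_ c sc)[v hv ->] [_ _ /(_ c sc)[v' hv' ->]].
by rewrite (is_improper_integral_unique hv hv').
Qed.

End improper_integrals.

Section stable_density.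
Context {R : realType}.
Implicit Types (beta t x : R) (p : R -> R).

Lemma stable_is_foxH beta t p x : 0 < beta < 1 -> 0 < t -> 0 < x ->
  stable_log_density beta t p ->
  is_foxH 0 1 (stable_upper beta) stable_lower (x / t `^ beta^-1)
    (beta * t `^ beta^-1 / x * p (ln x))%:C.
Proof.
move=> b01 t0 x0 hp; have /andP[b0 _] := b01.
have T0 : 0 < t `^ beta^-1 by exact: powR_gt0.
split.
- split=> //.
  + by move=> k; rewrite mem_seq1 => /eqP ->; rewrite invr_gt0.
  + by move=> l; rewrite mem_seq1 => /eqP ->.
  + exact: divr_gt0.
- by exists 0; apply/stable_separates.
move=> c /(stable_separates _ b0) c1.
have u0 : 0 < 1 - c by rewrite subr_gt0.
have [iC iS eC eS] := mellin_inversion (ln x) b01 t0 u0 hp.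
(* The factor i comes from ds = i dy and cancels in the division by 2 pi i. *)
pose k : R[i] := (beta * t `^ beta^-1 / x)%:C * 'i%R.
pose g y : R[i] := cos_part (1 - c) (ln x) p y +i* sin_part (1 - c) (ln x) p y.
have ig : cintegrable g by [].
exists (k * cint g).
  rewrite -cint_scale// /is_vertical_integral.
  have -> : (fun y => foxH_chi 0 1 (stable_upper beta) stable_lower (c +i* y) *
      cpow (x / t `^ beta^-1) (- (c +i* y)) * 'i) = (fun y => k * g y).
    apply/funext => y; rewrite (stable_chi_line y b0 t0 x0 c1 hp).
    by rewrite (mellin_cos_sin (ln x) y b0 t0 u0 hp) /k mulrAC.
  exact/is_improper_integral_cint/cintegrable_scale.
have -> : cint g = (2 * pi * p (ln x))%:C by rewrite /cint eC eS.
have i0 : 'i%R != 0 :> R[i] by rewrite eq_complex /= oner_eq0 andbF.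
have pi0 : (2 * pi : R)%:C != 0 :> R[i].
  by rewrite fmorph_eq0 mulf_neq0 ?pnatr_eq0// gt_eqF ?pi_gt0.
have -> : 2 * (pi : R)%:C = (2 * pi)%:C :> R[i] by rewrite rmorphM rmorph_nat.
have mulC (a b : R) : (a * b)%:C = a%:C * b%:C by rewrite rmorphM.
rewrite mulC [(2 * pi * _)%:C]mulC /k.
move: (2 * pi)%:C (_ / x)%:C (p _)%:C 'i%R pi0 i0 => q a b j q0 j0.
by field; rewrite q0 j0.
Qed.

End stable_density.

Unset Implicit Arguments.
Theorem theorem3p1 (R : realType) (d : measure_display) (T : measurableType d)
    (P : probability T R) (D : R -> {RV P >-> R}) (f : R -> R -> R)
    (beta t : R) (hbeta : 0 < beta < 1) (ht : 0 < t)
    (hD : stable_subordinator beta D)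
    (hf : is_continuous_density (D t) (fun x => f x t))
    (x : R) (hx : 0 < x) :
  let up := [:: (1 - (beta^-1)%:C, beta^-1)] in
  let lo := [:: (0, 1)] in
  let z := x / t `^ beta^-1 in
  (exists h : R[i], is_foxH 0 1 up lo z h) /\
  (f x t)%:C = ((beta * t `^ beta^-1)^-1)%:C * foxH 0 1 up lo z.
Proof.
move=> up lo z.
have hp := stable_subordinator_log_density ht hD hf.
have hH := stable_is_foxH hbeta ht hx hp.
(* Existence guarantees that [foxH] below is a genuine value and not its default 0. *)
split; first by eexists; exact: hH.
have /andP[b0 _] := hbeta; have T0 : 0 < t `^ beta^-1 by exact: powR_gt0.
(* The logarithmic density at ln x is f(x, t) x, whose factor x cancels the 1/x in the value of the
   H-function. *)
rewrite (foxHE hH) -rmorphM lnK ?posrE//; congr (_%:C); field.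
by rewrite !gt_eqF.
Qed.
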